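(* Let $T\subset\mathbb{R}^3$ be a polyhedron. (i) For every integer $k\ge 0$, the composite weak gradient $\nabla_w: V_k^{(1)}(T)\to V_k^{(2)}(T)$ and the composite weak curl $\nabla_w\times: V_k^{(2)}(T)\to V_k^{(3)}(T)$ satisfy $$\nabla_w\times(\nabla_w v)=0\qquad\text{for all } v\in V_k^{(1)}(T).$$ (ii) For every integer $k\ge 3$, the composite weak gradient $\nabla_w: W_k^{(1)}(T)\to W_{k-1}^{(2)}(T)$ and the composite weak curl $\nabla_w\times: W_{k-1}^{(2)}(T)\to W_{k-2}^{(3)}(T)$ satisfy $$\nabla_w\times(\nabla_w v)=0\qquad\text{for all } v\in W_k^{(1)}(T).$$
   Context: Geometry and notation. $T\subset\mathbb{R}^3$ is a (closed, bounded) polyhedron with flat polygonal faces, each edge being shared by exactly two faces. $F(T)$, $E(T)$, $V(T)$ are its sets of faces, edges and vertices. $P_j(D)$ is the space of polynomials of total degree at most $j$ on $D$ ($D$ a volume, a face or an edge). $(\cdot,\cdot)_D$ is the $L^2$ inner product on $D$ (volume, surface or curve; for the two end points $\partial e$ of an edge it is the sum of values at the end points). $\mathbf{n}$ is the unit outward normal on $\partial T$. For a face $f$, $\mathbf{n}_f$ is a fixed unit normal, $\mathbf{t}_{f,1},\mathbf{t}_{f,2}$ are orthogonal unit vectors tangential to $f$, and $\mathbf{t}=\mathbf{t}_{\partial f}$ is the unit tangent on $\partial f$ oriented by the right-hand rule with respect to $\mathbf{n}_f$. For an edge $e$, $\mathbf{t}_e$ is a fixed unit tangent vector and $\mathbf{n}_{\partial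 e}$ is the unit outward direction (along the edge) at its two end points. Generic spaces. For $D=T$, $f$, $e$ and integer $j\ge0$ put - $X_j(T)=[P_j(T)]^3$, - $X_j(f)=\{u_1\mathbf{t}_{f,1}+u_2\mathbf{t}_{f,2}: u_1,u_2\in P_j(f)\}$, - $X_j(e)=\{u\mathbf{t}_e: u\in P_j(e)\}$, - $N_j(f)=\{w_f\mathbf{n}_f: w_f\in P_j(f)\}$. Equal-order spaces ($k\ge0$): - $V_k^{(1)}(T)=\{v=\{v_0,v_f,v_e,v_n\}: v_0\in P_k(T), v_f\in P_k(f), v_e\in P_k(e), v_n\in\mathbb{R}, f\in F(T), e\in E(T), n\in V(T)\}$ (one component for each face, edge and vertex, independent of each other), - $V_k^{(2)}(T)=\{\mathbf{u}=\{\mathbf{u}_0,\mathbf{u}_f,\mathbf{u}_e\}: \mathbf{u}_0\in X_k(T),\mathbf{u}_f\in X_k(f),\mathbf{u}_e\in X_k(e)\}$, - $V_k^{(3)}(T)=\{\mathbf{w}=\{\mathbf{w}_0,\mathbf{w}_f\}: \mathbf{w}_0\in X_k(T),\mathbf{w}_f\in N_k(f)\}$. Descending-order spaces ($k\ge3$): - $W_k^{(1)}(T)=\{v=\{v_0,v_f,v_e,v_n\}: v_0\in P_k(T), v_f\in P_{k-1}(f), v_e\in P_{k-2}(e), v_n\in\mathbb{R}\}$, - $W_{k-1}^{(2)}(T)=\{\{\mathbf{u}_0,\mathbf{u}_f,\mathbf{u}_e\}: \mathbf{u}_0\in X_{k-1}(T),\mathbf{u}_f\in X_{k-2}(f),\mathbf{u}_e\in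 X_{k-3}(e)\}$, - $W_{k-2}^{(3)}(T)=\{\{\mathbf{w}_0,\mathbf{w}_f\}: \mathbf{w}_0\in X_{k-2}(T),\mathbf{w}_f\in N_{k-3}(f)\}$. Weak gradient. $\nabla_w v=\{\nabla_{w,0}v,\nabla_{w,f}v,\nabla_{w,e}v\}$, where $\nabla_{w,0}v\in X_a(T)$, $\nabla_{w,f}v\in X_b(f)$, $\nabla_{w,e}v\in X_c(e)$ are determined by $$(\nabla_{w,0}v,\varphi)_T=-(v_0,\nabla\cdot\varphi)_T+(v_f,\varphi\cdot\mathbf{n})_{\partial T}\quad\forall\varphi\in X_a(T),$$ $$(\nabla_{w,f}v,\theta\times\mathbf{n}_f)_f=-(v_f,(\nabla\times\theta)\cdot\mathbf{n}_f)_f+(v_e,\theta\cdot\mathbf{t}_{\partial f})_{\partial f}\quad\forall\theta\in X_b(f),$$ $$(\nabla_{w,e}v,\varphi\mathbf{t}_e)_e=-(v_e,\nabla\varphi\cdot\mathbf{t}_e)_e+(v_n,\varphi\,\mathbf{t}_e\cdot\mathbf{n}_{\partial e})_{\partial e}\quad\forall\varphi\mathbf{t}_e\in X_c(e),$$ with $(a,b,c)=(k,k,k)$ for $v\in V_k^{(1)}(T)$ and $(a,b,c)=(k-1,k-2,k-3)$ for $v\in W_k^{(1)}(T)$. Weak curl. $\nabla_w\times\mathbf{u}=\{\nabla_{w,0}\times\mathbf{u},\nabla_{w,f}\times\mathbf{u}\}$, where $\nabla_{w,0}\times\mathbf{u}\in X_a(T)$ and $\nabla_{w,f}\times\mathbf{u}\in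 N_b(f)$ are determined by $$(\nabla_{w,0}\times\mathbf{u},\theta)_T=(\mathbf{u}_0,\nabla\times\theta)_T+(\mathbf{u}_f,\theta\times\mathbf{n})_{\partial T}\quad\forall\theta\in X_a(T),$$ $$(\nabla_{w,f}\times\mathbf{u},\tau\mathbf{n}_f)_f=(\mathbf{u}_f,\nabla\tau\times\mathbf{n}_f)_f+(\mathbf{u}_e,\tau\mathbf{t})_{\partial f}\quad\forall\tau\mathbf{n}_f\in N_b(f),$$ with $(a,b)=(k,k)$ for $\mathbf{u}\in V_k^{(2)}(T)$ and $(a,b)=(k-2,k-3)$ for $\mathbf{u}\in W_{k-1}^{(2)}(T)$. *)

(* Defs.v *)
From HB Require Import structures.
From mathcomp Require Import all_boot all_order all_algebra.
From mathcomp Require Import all_classical all_reals all_analysis.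
From mathcomp Require mpoly.
(* The notations of [mpoly] clash with those of MathComp-Analysis. *)
Import -(notations) mpoly.
Import numFieldNormedType.Exports.
Import Order.TTheory GRing.Theory Num.Theory.

Set Implicit Arguments.
Unset Strict Implicit.
Unset Printing Implicit Defensive.

Local Open Scope classical_set_scope.
Local Open Scope ring_scope.

Section VectorCalculus.
Variable A : pzRingType.
Implicit Types u v : 'rV[A]_3.

Definition dot u v : A := \sum_i u 0 i * v 0 i.

(* Indices are added modulo 3. *)
Definition cross u v : 'rV[A]_3 :=
  \row_(i < 3) (u 0 (i + 1) * v 0 (i + 2) - u 0 (i + 2) * v 0 (i + 1)).

End VectorCalculus.

Section Polynomials.
Variable R : realType.
Local Notation poly3 := (mpoly 3 R).
Implicit Types (p : poly3) (q : 'rV[poly3]_3) (x : 'rV[R]_3).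

Definition peval p x : R := meval (x 0) p.
Definition veval q x : 'rV[R]_3 := \row_i peval (q 0 i) x.

Definition grad p : 'rV[poly3]_3 := \row_(i < 3) mderiv i p.
Definition div q : poly3 := \sum_(i < 3) mderiv i (q 0 i).
Definition curl q : 'rV[poly3]_3 :=
  \row_(i < 3) (mderiv (i + 1) (q 0 (i + 2)) - mderiv (i + 2) (q 0 (i + 1))).

(* [msize] is one more than the total degree, and [msize 0 = 0]. *)
Definition degle (j : nat) p : Prop := (msize p <= j.+1)%N.
Definition vdegle (j : nat) q : Prop := forall i, degle j (q 0 i).

(* P_j(D): restrictions to D of polynomials of total degree at most j.
   A function on D is represented by its extension by 0 to the whole space, so
   that equality of functions on D is Leibniz equality.  On a flat face or on
   an edge this is the space of polynomials of degree at most j in a Cartesian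
   coordinate system of the face or edge. *)
Definition Pspace (j : nat) (D : set 'rV[R]_3) : set ('rV[R]_3 -> R) :=
  [set g | exists2 p : poly3, degle j p & g = patch (fun=> 0) D (peval p)].

End Polynomials.

(* A solid with finitely many labelled faces, edges and vertices.
   The face f lives in the plane through [forig f] spanned by the orthonormal
   pair ([ft1 f], [ft2 f]) and is described by a planar region [freg f] in the
   corresponding coordinates; [fnor f] is the fixed unit normal n_f.
   The order of the two end points of an edge fixes the unit tangent t_e. *)
Record solid_complex (R : realType) := SolidComplex {
  solid : set 'rV[R]_3 ;
  face : finType ;
  edge : finType ;
  vertex : finType ;
  vpos : vertex -> 'rV[R]_3 ;
  etail : edge -> vertex ;
  ehead : edge -> vertex ;
  forig : face -> 'rV[R]_3 ;
  ft1 : face -> 'rV[R]_3 ;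
  ft2 : face -> 'rV[R]_3 ;
  fnor : face -> 'rV[R]_3 ;
  freg : face -> set (R * R)
}.

Section Polyhedron.
Variables (R : realType) (T : solid_complex R).
Implicit Types (f : face T) (e : edge T) (m : vertex T) (x : 'rV[R]_3).

Definition chart f (p : R * R) : 'rV[R]_3 :=
  forig f + p.1 *: ft1 f + p.2 *: ft2 f.
Definition fset f : set 'rV[R]_3 := chart f @` freg f.
Definition frelint f : set 'rV[R]_3 := chart f @` (freg f)°.
Definition frelbd f : set 'rV[R]_3 := chart f @` (freg f `\` (freg f)°).

Definition evec e : 'rV[R]_3 := vpos (ehead e) - vpos (etail e).
(* Euclidean length; the norm of the library on ['rV[R]_3] is the max norm. *)
Definition elen e : R := Num.sqrt (dot (evec e) (evec e)).
Definition etan e : 'rV[R]_3 := (elen e)^-1 *: evec e.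
Definition eset e : set 'rV[R]_3 :=
  (fun s : R => vpos (etail e) + s *: evec e) @` `[0, 1].
Definition erelint e : set 'rV[R]_3 :=
  (fun s : R => vpos (etail e) + s *: evec e) @` `]0, 1[.

Definition ends e : {set vertex T} := [set etail e; ehead e]%SET.
(* The outward direction along e at its end point m. *)
Definition eout e m : 'rV[R]_3 := if m == ehead e then etan e else - etan e.

(* The edges that make up the boundary of f. *)
Definition bedges f : {set edge T} := [set e | `[< eset e `<=` fset f >]]%SET.

Record is_polyhedron : Prop := IsPolyhedron {
  (* closed bounded solid whose boundary is the union of the faces *)
  solid_compact : compact (@solid R T) ;
  solid_regular : closure (@solid R T)° = @solid R T ;
  solid_boundary :
    @solid R T `\` (@solid R T)° = \bigcup_(f in [set: face T]) fset f ;
  (* vertices and edges *)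
  vpos_inj : injective (@vpos R T) ;
  ends_neq : forall e, etail e != ehead e ;
  vertex_end : forall m, exists e, m \in ends e ;
  edges_meet : forall e e' x, e != e' -> eset e x -> eset e' x ->
    exists m, [/\ m \in ends e, m \in ends e' & x = vpos m] ;
  (* each face is a plane polygon: a closed region bounded by finitely many
     edges, two of which meet at each of its vertices *)
  frame_unit : forall f, [/\ dot (ft1 f) (ft1 f) = 1,
    dot (ft2 f) (ft2 f) = 1 & dot (fnor f) (fnor f) = 1] ;
  frame_orth : forall f, [/\ dot (ft1 f) (ft2 f) = 0,
    dot (ft1 f) (fnor f) = 0 & dot (ft2 f) (fnor f) = 0] ;
  freg_neq0 : forall f, freg f !=set0 ;
  freg_compact : forall f, compact (freg f) ;
  freg_regular : forall f, closure (freg f)° = freg f ;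
  freg_connected : forall f, connected (freg f)° ;
  face_boundary : forall f,
    frelbd f = \bigcup_(e in [set e | e \in bedges f]) eset e ;
  face_vertex : forall f m, fset f (vpos m) ->
    #|[set e in bedges f | m \in ends e]%SET| = 2%N ;
  (* distinct faces meet at most along their boundaries, and each edge is
     shared by exactly two faces *)
  faces_meet : forall f f', f != f' -> frelint f `&` fset f' = set0 ;
  edge_faces : forall e, #|[set f | e \in bedges f]%SET| = 2%N
}.

(* n is the unit outward normal on the face f. *)
Definition outward_normal f (n : 'rV[R]_3) : Prop :=
  (n = fnor f \/ n = - fnor f) /\
  forall x, frelint f x ->
    \forall s \near 0^'+, @solid R T (x - s *: n) /\ ~ @solid R T (x + s *: n).

(* t is the unit tangent on the part e of the boundary of f, oriented by the
   right-hand rule with respect to n_f: the vector n_f x t points into f. *)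
Definition right_hand_tangent f e (t : 'rV[R]_3) : Prop :=
  (t = etan e \/ t = - etan e) /\
  forall x, erelint e x ->
    \forall s \near 0^'+, fset f (x + s *: cross (fnor f) t) /\
                          ~ fset f (x - s *: cross (fnor f) t).

(* Volume, surface and curve integrals.  The last two use arc-length
   parametrizations, for which no Jacobian factor appears. *)
Local Notation mu := (@lebesgue_measure R).

Definition point3 (p : R * R * R) : 'rV[R]_3 :=
  \row_(i < 3) [:: p.1.1; p.1.2; p.2]`_i.

Definition intT (g : 'rV[R]_3 -> R) : R :=
  (\int[((mu \x mu) \x mu)%E]_(p in [set p | @solid R T (point3 p)])
     g (point3 p))%R.
Definition intF f (g : 'rV[R]_3 -> R) : R :=
  (\int[(mu \x mu)%E]_(p in freg f) g (chart f p))%R.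
Definition intE e (g : 'rV[R]_3 -> R) : R :=
  (\int[mu]_(s in `[0%R, elen e]) g (vpos (etail e) + s *: etan e))%R.

(* X_j(T), X_j(f), N_j(f), X_j(e) *)
Definition XT (j : nat) : set ('rV[R]_3 -> 'rV[R]_3) :=
  [set u | forall i, Pspace j (@solid R T) (fun x => u x 0 i)].
Definition XF (j : nat) f : set ('rV[R]_3 -> 'rV[R]_3) :=
  [set u | exists u1 u2, [/\ Pspace j (fset f) u1, Pspace j (fset f) u2 &
     u = (fun x => u1 x *: ft1 f + u2 x *: ft2 f)]].
Definition NF (j : nat) f : set ('rV[R]_3 -> 'rV[R]_3) :=
  [set w | exists2 wf, Pspace j (fset f) wf & w = (fun x => wf x *: fnor f)].
Definition XE (j : nat) e : set ('rV[R]_3 -> 'rV[R]_3) :=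
  [set u | exists2 ue, Pspace j (eset e) ue & u = (fun x => ue x *: etan e)].

Record cochain1 := Cochain1 {
  v_0 : 'rV[R]_3 -> R ;
  v_f : face T -> 'rV[R]_3 -> R ;
  v_e : edge T -> 'rV[R]_3 -> R ;
  v_n : vertex T -> R
}.
Record cochain2 := Cochain2 {
  u_0 : 'rV[R]_3 -> 'rV[R]_3 ;
  u_f : face T -> 'rV[R]_3 -> 'rV[R]_3 ;
  u_e : edge T -> 'rV[R]_3 -> 'rV[R]_3
}.
Record cochain3 := Cochain3 {
  w_0 : 'rV[R]_3 -> 'rV[R]_3 ;
  w_f : face T -> 'rV[R]_3 -> 'rV[R]_3
}.

Definition zero3 : cochain3 := Cochain3 (fun=> 0) (fun _ _ => 0).

Definition space1 (a b c : nat) : set cochain1 :=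
  [set v | [/\ Pspace a (@solid R T) (v_0 v),
    forall f, Pspace b (fset f) (v_f v f) &
    forall e, Pspace c (eset e) (v_e v e)]].

Definition V1 (k : nat) : set cochain1 := space1 k k k.
Definition W1 (k : nat) : set cochain1 := space1 k (k - 1) (k - 2).

(* The weak operators are the unique solutions, in the indicated spaces, of
   their defining equations; existence and uniqueness follow from the Riesz
   representation theorem, so that the default value of [xget] is never used.
   Test functions are given by polynomials on the whole space.  On faces and
   edges only tangential derivatives of these occur, so that the equations
   depend only on the restrictions of the test functions. *)
Variables (n : face T -> 'rV[R]_3) (t : face T -> edge T -> 'rV[R]_3).

Definition wgrad_0 (a : nat) (v : cochain1) : 'rV[R]_3 -> 'rV[R]_3 :=
  xget (fun=> 0) [set u | XT a u /\
    forall phi, vdegle a phi ->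
      intT (fun x => dot (u x) (veval phi x)) =
      - intT (fun x => v_0 v x * peval (div phi) x) +
      \sum_f intF f (fun x => v_f v f x * dot (veval phi x) (n f))].

Definition wgrad_f (b : nat) (v : cochain1) f : 'rV[R]_3 -> 'rV[R]_3 :=
  xget (fun=> 0) [set u | XF b f u /\
    forall theta1 theta2, degle b theta1 -> degle b theta2 ->
      let theta := \row_(i < 3) (ft1 f 0 i *: theta1 + ft2 f 0 i *: theta2) in
      intF f (fun x => dot (u x) (cross (veval theta x) (fnor f))) =
      - intF f (fun x => v_f v f x * dot (veval (curl theta) x) (fnor f)) +
      \sum_(e in bedges f)
        intE e (fun x => v_e v e x * dot (veval theta x) (t f e))].

Definition wgrad_e (c : nat) (v : cochain1) e : 'rV[R]_3 -> 'rV[R]_3 :=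
  xget (fun=> 0) [set u | XE c e u /\
    forall phi, degle c phi ->
      intE e (fun x => dot (u x) (peval phi x *: etan e)) =
      - intE e (fun x => v_e v e x * dot (veval (grad phi) x) (etan e)) +
      \sum_(m in ends e)
        v_n v m * (peval phi (vpos m) * dot (etan e) (eout e m))].

Definition wgrad (a b c : nat) (v : cochain1) : cochain2 :=
  Cochain2 (wgrad_0 a v) (wgrad_f b v) (wgrad_e c v).

Definition wcurl_0 (a : nat) (u : cochain2) : 'rV[R]_3 -> 'rV[R]_3 :=
  xget (fun=> 0) [set w | XT a w /\
    forall theta, vdegle a theta ->
      intT (fun x => dot (w x) (veval theta x)) =
      intT (fun x => dot (u_0 u x) (veval (curl theta) x)) +
      \sum_f intF f (fun x => dot (u_f u f x) (cross (veval theta x) (n f)))].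

Definition wcurl_f (b : nat) (u : cochain2) f : 'rV[R]_3 -> 'rV[R]_3 :=
  xget (fun=> 0) [set w | NF b f w /\
    forall tau, degle b tau ->
      intF f (fun x => dot (w x) (peval tau x *: fnor f)) =
      intF f (fun x =>
        dot (u_f u f x) (cross (veval (grad tau) x) (fnor f))) +
      \sum_(e in bedges f)
        intE e (fun x => dot (u_e u e x) (peval tau x *: t f e))].

Definition wcurl (a b : nat) (u : cochain2) : cochain3 :=
  Cochain3 (wcurl_0 a u) (wcurl_f b u).

End Polyhedron.

(* Main.v *)
(* Testing the weak curl of a weak gradient and inserting the defining equations
   of the components of the gradient, all integrals of v_0 and v_f cancel,
   because div curl = 0, curl grad = 0 and theta x n_f only sees the tangential
   part of theta.  What remains in the volume equation is, for each edge, the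
   integral of v_e times the tangential part of theta, with coefficient the sum
   of the orientations induced by the two adjacent faces; in the equation on a
   face it is, for each vertex, a multiple of v_n with coefficient the sum of the
   orientations of the two adjacent edges.  Both sums vanish, because the two
   rays bounding a planar sector see it on opposite sides.

   The components of the weak gradient exist by the Riesz representation theorem
   on a finite-dimensional space of polynomials.  For this the right-hand sides
   must only depend on the restrictions of the test functions: if a polynomial
   vanishes on the solid, on a face or on an edge, so do its tangential
   derivatives. *)

Require Import Defs.
From HB Require Import structures.
From mathcomp Require Import all_boot all_order all_algebra.
From mathcomp Require Import all_classical all_reals all_analysis.
From mathcomp Require Import measurable_realfun lebesgue_Rintegral ring lra.
From mathcomp Require mpoly.
Import -(notations) mpoly.
Import numFieldNormedType.Exports.
Import Order.TTheory GRing.Theory Num.Theory.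

Set Implicit Arguments.
Unset Strict Implicit.
Unset Printing Implicit Defensive.

Local Open Scope classical_set_scope.
Local Open Scope ring_scope.

(** * Integrals of polynomials over the solid, its faces and its edges *)

Section Polynomials.
Variable R : realType.
Local Notation poly3 := (mpoly 3 R).

(** All three kinds of integrals enter through the interface [integral_on], so that one Riesz
    argument serves the solid, the faces and the edges. The two operators are treated
    asymmetrically. The gradient has to satisfy its equations, which calls for existence. For the
    curl definiteness is enough: [xget] returns zero if there is no solution, and any solution is
    tested against itself.

    The polynomial degrees matter through four inequalities only: a test function of the curl, or
    its own curl or gradient, must be admissible in the equations of the gradient. Both families of
    spaces satisfy them, so (i) and (ii) are instances of one statement.

    The geometric obstacle is that normals and tangents are fixed by what happens right next to a
    single face or edge, while the cancellation compares two faces at an edge or two edges at a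
    vertex. The comparison takes place in a plane, orthogonal to the edge or containing the face,
    where the boundary near the point lies on two rays; connectedness of a segment carries
    information from one ray to the other. *)

Lemma mpoly_ring_ind (P : poly3 -> Prop) :
  (forall c, P (mpolyC 3 c)) -> (forall i, P (mpolyX R (mnm1 i))) ->
  (forall p q, P p -> P q -> P (p + q)) ->
  (forall p q, P p -> P q -> P (p * q)) -> forall p, P p.
Proof.
move=> PC PX PD PM; elim/mpolyind => [|c m p _ _ Pp].
  by rewrite -(mpolyC0 3 R).
apply: PD => //; rewrite -mul_mpolyC; apply: (PM) => //.
rewrite mpolyXE_id; elim/big_rec: _ => [|i q _ Pq]; first exact: PC.
apply: (PM) => //; elim: (m i) => [|k Pk]; first by rewrite expr0; exact: PC.
by rewrite exprS; exact: PM.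
Qed.

Lemma pevalC c x : peval (mpolyC 3 c) x = c :> R.
Proof. exact: mevalC. Qed.
Lemma pevalX i x : peval (mpolyX R (mnm1 i)) x = x 0 i.
Proof. exact: mevalXU. Qed.
Lemma pevalD (p q : poly3) x : peval (p + q) x = peval p x + peval q x.
Proof. exact: mevalD. Qed.
Lemma pevalM (p q : poly3) x : peval (p * q) x = peval p x * peval q x.
Proof. exact: mevalM. Qed.
Lemma pevalZ c (p : poly3) x : peval (c *: p) x = c * peval p x.
Proof. exact: mevalZ. Qed.

Lemma continuous_peval (p : poly3) : continuous (peval p).
Proof.
elim/mpoly_ring_ind: p => [c|i|p q cp cq|p q cp cq] x.
- rewrite (funext (pevalC c)); exact: cst_continuous.
- rewrite (funext (pevalX i)); exact: coord_continuous.
- rewrite (funext (pevalD p q)); exact: (continuousD (cp x) (cq x)).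
- rewrite (funext (pevalM p q)); exact: (continuousM (cp x) (cq x)).
Qed.

Section MeasurePoly.
Variables (d : measure_display) (Y : measurableType d).
Variables (A : set Y) (g : Y -> 'rV[R]_3).

Lemma measurable_peval (p : poly3) :
  (forall i, measurable_fun A (fun y => g y 0 i)) ->
  measurable_fun A (fun y => peval p (g y)).
Proof.
move=> mg; elim/mpoly_ring_ind: p => [c|i|p q mp mq|p q mp mq].
- under eq_fun do rewrite pevalC; exact: measurable_cst.
- under eq_fun do rewrite pevalX; exact: mg.
- under eq_fun do rewrite pevalD; exact: (measurable_funD mp mq).
- under eq_fun do rewrite pevalM; exact: measurable_funM.
Qed.

End MeasurePoly.

Lemma bounded_peval (p : poly3) (D : set 'rV[R]_3) M :
  (forall x i, D x -> `|x 0 i| <= M) ->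
  exists N, forall x, D x -> `|peval p x| <= N.
Proof.
move=> DM; elim/mpoly_ring_ind: p =>
  [c|i|p q [N pN] [N' qN']|p q [N pN] [N' qN']].
- by exists `|c| => x _; rewrite pevalC.
- by exists M => x Dx; rewrite pevalX; exact: DM.
- exists (N + N') => x Dx; rewrite pevalD (le_trans (ler_normD _ _))//.
  by apply: lerD; [exact: pN|exact: qN'].
- exists (N * N') => x Dx; rewrite pevalM normrM.
  by apply: ler_pM => //; [exact: pN|exact: qN'].
Qed.

(** These are the properties of an inner product on the restrictions of polynomials to [D].
    Definiteness asks for vanishing at every point of [D], not merely almost everywhere. *)
Record integral_on (D : set 'rV[R]_3) (I : poly3 -> R) : Prop := IntegralOn {
  integral_on_linear : forall c p q, I (c *: p + q) = c * I p + I q ;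
  integral_on_ext : forall p q,
    (forall x, D x -> peval p x = peval q x) -> I p = I q ;
  integral_on_definite : forall p, (forall x, D x -> 0 <= peval p x) ->
    I p = 0 -> forall x, D x -> peval p x = 0 }.

(** The last hypothesis makes every nonempty relatively open part of the image carry positive
    measure. Hence a nonnegative polynomial that is positive at one point cannot have integral
    zero. *)
Lemma integral_on_image d (Y : measurableType d)
    (mu : {measure set Y -> \bar R})
    (A : set Y) (g : Y -> 'rV[R]_3) M :
  measurable A -> (mu A < +oo)%E ->
  (forall i, measurable_fun A (fun y => g y 0 i)) ->
  (forall y i, A y -> `|g y 0 i| <= M) ->
  (forall (O : set 'rV[R]_3) y, open O -> A y -> O (g y) ->
    exists B, [/\ measurable B, B `<=` A, forall z, B z -> O (g z)
      & (0 < mu B)%E]) ->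
  integral_on (g @` A) (fun p => \int[mu]_(y in A) peval p (g y)).
Proof.
move=> mA Aoo mg gM pos.
have intp p : mu.-integrable A (EFin \o (fun y => peval p (g y))).
  apply: measurable_bounded_integrable => //; first exact: measurable_peval.
  have DM x i : (g @` A) x -> `|x 0 i| <= M by move=> [y Ay <-]; exact: gM.
  have [N pN] := @bounded_peval p (g @` A) M DM.
  exists N; split; first exact: num_real.
  move=> K NK y Ay /=; apply: le_trans (ltW NK); apply: pN; by exists y.
split.
- move=> c p q; under eq_Rintegral do rewrite pevalD pevalZ.
  rewrite RintegralD//; last first.
    apply: eq_integrable (intp (c *: p)) => // y _ /=; by rewrite pevalZ.
  by rewrite RintegralZl.
- move=> p q pq; apply: eq_Rintegral => y /[!inE] Ay; apply: pq; by exists y.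
- move=> p p0 I0 _ [y Ay <-]; apply: contrapT => py.
  have py0 : 0 < peval p (g y) by rewrite lt_neqAle eq_sym; apply/andP; split;
    [exact/eqP|apply: p0; exists y].
  have oO : open [set x | 0 < peval p x].
    rewrite (_ : mkset _ = peval p @^-1` `]0, +oo[%classic); last first.
      by apply/seteqP; split => x /=; rewrite in_itv /= andbT.
    by apply: open_comp => // x _; exact: continuous_peval.
  have [B [mB BA BO]] := pos _ y oO Ay py0.
  apply/negP; rewrite -leNgt.
  have E0 : (\int[mu]_(y in A) `|(peval p (g y))%:E| = 0)%E.
    rewrite (eq_integral (EFin \o (fun y => peval p (g y)))).
      rewrite -[LHS]fineK; last exact: integrable_fin_num.
      by congr EFin.
    move=> z /[!inE] Az /=; rewrite ger0_norm //; apply: p0; by exists z.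
  have /(ae_eq_integral_abs _ mA) [|N [mN N0 AN]] := E0.
    by apply/measurable_EFinP; exact: measurable_peval.
  (* On [B] the polynomial is positive, so [B] lies in the null set [N] off which it vanishes. *)
  rewrite -N0; apply: le_measure; rewrite ?inE // => z Bz; apply: AN.
  move=> /= /(_ (BA _ Bz)) [pz0]; have := BO _ Bz.
  by rewrite /= pz0 ltxx.
Qed.
End Polynomials.

(** * Open and bounded sets under product measures *)

Section ProductMeasure.
Variable R : realType.
Local Notation mu := (@lebesgue_measure R).

(** The balls with rational centre and radius 1/(k+1) form a countable basis of the last factor, so
    [U] is a countable union of measurable rectangles. Keeping [Y] abstract allows the passage from
    the line to the plane and then to space. *)
Lemma measurable_slabs d (Y : measurableType d) (U : set (Y * R))
    (V : rat -> nat -> set Y) :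
  (forall q k, measurable (V q k)) ->
  (forall q k y z, V q k y -> ball (ratr q : R) k.+1%:R^-1 z -> U (y, z)) ->
  (forall y z, U (y, z) -> exists2 e : R, 0 < e &
     forall q k, ball (ratr q : R) k.+1%:R^-1 `<=` ball z e -> V q k y) ->
  measurable U.
Proof.
move=> mV VU UV.
have -> : U = \bigcup_q \bigcup_k (V q k `*` ball (ratr q : R) k.+1%:R^-1).
  apply/seteqP; split => [[y z] Uyz|[y z] [q _ [k _ [/= Vy Bz]]]]; last first.
    exact: VU Vy Bz.
  have [e e0 eV] := UV _ _ Uyz.
  have [k ke] : exists k, k.+1%:R^-1 < e / 2.
    have : \forall k \near \oo, k.+1%:R^-1 < e / 2.
      exact: (near_infty_natSinv_lt (PosNum (divr_gt0 e0 (ltr0n R 2)))).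
    by case=> k _ /(_ k (leqnn k)); exists k.
  have k0 : 0 < k.+1%:R^-1 :> R by rewrite invr_gt0.
  have [q] : exists q, ball (ratr q : R) k.+1%:R^-1 z.
    have [w [zw [q _ qE]]] :=
      dense_rat (ex_intro _ z (ballxx z k0)) (ball_open z _).
    by exists q; apply: ball_sym; rewrite qE.
  move=> qz; exists q => //; exists k => //; split => //=.
  apply: eV => u qu; rewrite (splitr e).
  apply: (ball_triangle (y := (ratr q : R))).
    by apply: le_ball (ball_sym qz); exact: ltW.
  by apply: le_ball qu; exact: ltW.
apply: bigcupT_measurable_rat => q; apply: bigcupT_measurable => k.
apply: measurableX => //; apply: open_measurable; exact: ball_open.
Qed.

Lemma interior_slab (Y : topologicalType) (U : set (Y * R)) y (z : R) :
  open U -> U (y, z) -> exists2 e, 0 < e &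
    forall B, B `<=` ball z e -> [set y' | B `<=` [set z' | U (y', z')]]° y.
Proof.
move=> oU Uyz.
have [[B C] [/= nB nC BC]] := open_nbhs_nbhs (conj oU Uyz).
have /nbhs_ballP [e /= e0 eC] := nC.
exists e => // D De; apply: filterS nB => y' By' z' Dz'.
by apply: (BC (y', z')); split => //; exact/eC/De.
Qed.

Lemma open_measurable2 (U : set (R * R)) : open U -> measurable U.
Proof.
(* The set of [y] whose slab over the ball lies in [U] need not be open, since the ball is not
   compact; its interior is, and suffices for the covering. *)
move=> oU; pose V q k :=
  [set y : R | ball (ratr q : R) k.+1%:R^-1 `<=` [set z | U (y, z)]]°.
apply: (@measurable_slabs _ _ _ V) => [q k|q k y z|y z Uyz].
- by apply: open_measurable; exact: open_interior.
- by move=> Vy Bz; exact: (interior_subset Vy).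
- by have [e e0 eP] := interior_slab oU Uyz; exists e => // q k; exact: eP.
Qed.

Lemma open_measurable3 (U : set (R * R * R)) : open U -> measurable U.
Proof.
move=> oU; pose V q k :=
  [set y : R * R | ball (ratr q : R) k.+1%:R^-1 `<=` [set z | U (y, z)]]°.
apply: (@measurable_slabs _ _ _ V) => [q k|q k y z|y z Uyz].
- by apply: open_measurable2; exact: open_interior.
- by move=> Vy Bz; exact: (interior_subset Vy).
- by have [e e0 eP] := interior_slab oU Uyz; exists e => // q k; exact: eP.
Qed.

Lemma measure_ball_gt0 (x e : R) : 0 < e -> (0 < mu (ball x e))%E.
Proof. by move=> e0; rewrite lebesgue_measure_ball ?ltW // lte_fin; lra. Qed.

Lemma open_measure_gt0 (U : set R) x : open U -> U x -> (0 < mu U)%E.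
Proof.
move=> oU Ux; have /nbhs_ballP [e /= e0 eU] := open_nbhs_nbhs (conj oU Ux).
apply: (lt_le_trans (measure_ball_gt0 x e0)).
apply: le_measure => //; rewrite inE; apply: open_measurable => //.
exact: ball_open.
Qed.

Lemma open_measure2_gt0 (U : set (R * R)) x :
  open U -> U x -> (0 < (mu \x mu)%E U)%E.
Proof.
move=> oU Ux.
have [[B C] [/= nB nC BC]] := open_nbhs_nbhs (conj oU Ux).
have pos : (0 < (mu \x mu)%E (B° `*` C°))%E.
  rewrite product_measure1E;
    [|(apply: open_measurable; exact: open_interior)..].
  exact: (mule_gt0 (open_measure_gt0 (@open_interior _ B) nB)
    (open_measure_gt0 (@open_interior _ C) nC)).
apply: (lt_le_trans pos); apply: le_measure; rewrite ?inE.
- by apply: measurableX; (apply: open_measurable; exact: open_interior).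
- exact: open_measurable2.
- by move=> [y z] [/= /interior_subset ? /interior_subset ?]; exact: BC.
Qed.

Lemma open_measure3_gt0 (U : set (R * R * R)) x :
  open U -> U x -> (0 < ((mu \x mu) \x mu)%E U)%E.
Proof.
move=> oU Ux.
have [[B C] [/= nB nC BC]] := open_nbhs_nbhs (conj oU Ux).
have pos : (0 < ((mu \x mu) \x mu)%E (B° `*` C°))%E.
  rewrite product_measure1E; [|(apply: open_measurable2; exact: open_interior)
    |(apply: open_measurable; exact: open_interior)].
  exact: (mule_gt0 (open_measure2_gt0 (@open_interior _ B) nB)
    (open_measure_gt0 (@open_interior _ C) nC)).
apply: (lt_le_trans pos); apply: le_measure; rewrite ?inE.
- by apply: measurableX; [(apply: open_measurable2; exact: open_interior)
    |(apply: open_measurable; exact: open_interior)].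
- exact: open_measurable3.
- by move=> [y z] [/= /interior_subset ? /interior_subset ?]; exact: BC.
Qed.

Lemma measure_box2_lty (A : set (R * R)) M : measurable A ->
  (forall y, A y -> `|y.1| <= M /\ `|y.2| <= M) -> ((mu \x mu)%E A < +oo)%E.
Proof.
move=> mA AM.
have fin : ((mu \x mu)%E (`[(-M)%R, M] `*` `[(-M)%R, M]) < +oo)%E.
  by rewrite product_measure1E //= lebesgue_measure_itv /=; case: ifP => _;
    rewrite ?mul0e // -EFinB -EFinM ltry.
apply: le_lt_trans fin; apply: le_measure; rewrite ?inE //.
  exact: measurableX.
by move=> y /AM[? ?]; split; rewrite /= in_itv /= -ler_norml.
Qed.

Lemma measure_box3_lty (A : set (R * R * R)) M : measurable A ->
  (forall y, A y -> [/\ `|y.1.1| <= M, `|y.1.2| <= M & `|y.2| <= M]) ->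
  (((mu \x mu) \x mu)%E A < +oo)%E.
Proof.
move=> mA AM.
have fin : (((mu \x mu) \x mu)%E
    ((`[(-M)%R, M] `*` `[(-M)%R, M]) `*` `[(-M)%R, M]) < +oo)%E.
  rewrite product_measure1E //=; last exact: measurableX.
  rewrite product_measure1E //= lebesgue_measure_itv /=; case: ifP => _;
    by rewrite ?mul0e // -EFinB -!EFinM ltry.
apply: le_lt_trans fin; apply: le_measure; rewrite ?inE //.
  by apply: measurableX => //; exact: measurableX.
by move=> y /AM[? ? ?]; split; [split|]; rewrite /= in_itv /= -ler_norml.
Qed.
End ProductMeasure.

Section Compact.
Variable R : realType.

Lemma compact_fun_bound (Y : topologicalType) (f : Y -> R) (K : set Y) :
  compact K -> continuous f -> exists M, forall x, K x -> `|f x| <= M.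
Proof.
move=> cK cf.
have cfK : {within K, continuous f} by exact: continuous_subspaceT.
have [M [_ MP]] := compact_bounded (continuous_compact cfK cK).
exists (M + 1) => x Kx; apply: MP; first by rewrite ltrDl.
by exists x.
Qed.

Lemma compact_coord_bound (K : set 'rV[R]_3) : compact K ->
  exists M, forall x i, K x -> `|x 0 i| <= M.
Proof.
move=> cK.
have /choice [M MP] : forall i, exists M, forall x, K x -> `|x 0 i| <= M.
  by move=> i; apply: compact_fun_bound => //; exact: coord_continuous.
exists (\sum_i `|M i|) => x i Kx; rewrite (bigD1 i) //=.
rewrite (le_trans (MP i x Kx)) // (le_trans (ler_norm _)) // lerDl.
exact: sumr_ge0.
Qed.

End Compact.

(** * Parametrizations of the solid, the faces and the edges *)

Section Charts.
Variables (R : realType) (T : solid_complex R).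

Lemma point3E (p : R * R * R) : point3 p =
  p.1.1 *: delta_mx 0 0 + p.1.2 *: delta_mx 0 1 + p.2 *: delta_mx 0 2.
Proof.
apply/rowP => -[[|[|[|//]]] H]; rewrite !mxE /= !(mulr1, mulr0, addr0, add0r).
all: rewrite ?(mulr1, mulr0, addr0, add0r) //.
Qed.

Lemma continuous_point3 : continuous (@point3 R).
Proof.
rewrite (funext point3E) => p.
have c1 : {for p, continuous (fun p : R * R * R => p.1.1)}.
  by apply: continuous_comp; [exact: cvg_fst|exact: cvg_fst].
have c2 : {for p, continuous (fun p : R * R * R => p.1.2)}.
  by apply: continuous_comp; [exact: cvg_fst|exact: cvg_snd].
have c3 : {for p, continuous (fun p : R * R * R => p.2)} by exact: cvg_snd.
by apply: cvgD; [apply: cvgD|]; exact: cvgZr_tmp.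
Qed.

Lemma point3_surj (x : 'rV[R]_3) : point3 (x 0 0, x 0 1, x 0 2) = x.
Proof.
apply/rowP => -[[|[|[|//]]] H]; rewrite !mxE /=; congr (x 0 _); exact: val_inj.
Qed.

Lemma continuous_chart f : continuous (@chart R T f).
Proof.
move=> p; rewrite /chart.
apply: cvgD; first apply: cvgD.
- exact: cvg_cst.
- by apply: cvgZr_tmp; exact: cvg_fst.
- by apply: cvgZr_tmp; exact: cvg_snd.
Qed.

Hypothesis hT : is_polyhedron T.

Lemma fset_compact f : compact (@fset R T f).
Proof.
apply: continuous_compact; last exact: freg_compact.
by apply: continuous_subspaceT; exact: continuous_chart.
Qed.

Lemma integral_on_solid :
  integral_on (@solid R T) (fun p => intT T (peval p)).
Proof.
have [M MP] := compact_coord_bound (solid_compact hT).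
have sE : @point3 R @` (@point3 R @^-1` solid T) = solid T.
  apply/seteqP; split => [_ [p ? <-] //|x Tx].
  by exists (x 0 0, x 0 1, x 0 2); rewrite /= point3_surj.
have cl : closed (@point3 R @^-1` solid T).
  apply: closed_comp => [p _|]; first exact: continuous_point3.
  by apply: compact_closed (solid_compact hT); exact: norm_hausdorff.
have mA : measurable (@point3 R @^-1` solid T).
  rewrite -[X in measurable X]setCK; apply: measurableC.
  by apply: open_measurable3; exact: closed_openC.
rewrite -sE; apply: (integral_on_image (M := M)
  (mu := ((@lebesgue_measure R \x @lebesgue_measure R)
    \x @lebesgue_measure R)%E)) => //.
- apply: (measure_box3_lty (M := M)) => // p Tp; split.
  + by have := MP _ 0 Tp; rewrite mxE.
  + by have := MP _ 1 Tp; rewrite mxE.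
  + by have := MP _ 2 Tp; rewrite mxE.
- move=> -[[|[|[|//]]] H]; (under eq_fun do rewrite mxE /=).
  + apply: measurable_funTS.
    by apply: measurableT_comp => //; exact: measurable_fst.
  + apply: measurable_funTS.
    by apply: measurableT_comp => //; exact: measurable_fst.
  + by apply: measurable_funTS; exact: measurable_snd.
- by move=> y i Ty; exact: MP.
- move=> O y oO Ty Oy.
  (* A boundary point of the solid is a limit of interior points, so each of its neighbourhoods
     meets the solid in a set of positive measure. *)
  have clT : closure (solid T)° (point3 y) by rewrite (solid_regular hT).
  have [x [xT xO]] := clT O (open_nbhs_nbhs (conj oO Oy)).
  pose B := @point3 R @^-1` ((solid T)° `&` O).
  have oB : open B.
    apply: open_comp => [p _|]; first exact: continuous_point3.
    by apply: openI => //; exact: open_interior.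
  exists B; split.
  + exact: open_measurable3.
  + by move=> p [/interior_subset].
  + by move=> p [].
  + by apply: (open_measure3_gt0 (x := (x 0 0, x 0 1, x 0 2))) => //;
      rewrite /B /= point3_surj.
Qed.

Lemma integral_on_face f :
  integral_on (@fset R T f) (fun p => intF f (peval p)).
Proof.
have [M MP] := compact_coord_bound (@fset_compact f).
have [M1 M1P] := compact_fun_bound (freg_compact hT (f := f))
  (fun p => cvg_fst (F := nbhs p.1) (G := nbhs p.2)).
have [M2 M2P] := compact_fun_bound (freg_compact hT (f := f))
  (fun p => cvg_snd (F := nbhs p.1) (G := nbhs p.2)).
have mA : measurable (@freg R T f).
  rewrite -[X in measurable X]setCK; apply: measurableC.
  apply: open_measurable2; apply: closed_openC.
  by apply: compact_closed (freg_compact hT (f := f)); exact: norm_hausdorff.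
apply: (integral_on_image (M := M)
  (mu := (@lebesgue_measure R \x @lebesgue_measure R)%E)) => //.
- apply: (measure_box2_lty (M := Num.max M1 M2)) => // p Tp.
  by rewrite !le_max M1P //= M2P //= orbT.
- move=> i; rewrite /chart; under eq_fun do rewrite !mxE.
  apply: measurable_funTS.
  apply: measurable_funD; first apply: measurable_funD => //.
    by apply: measurable_funM => //; exact: measurable_fst.
  by apply: measurable_funM => //; exact: measurable_snd.
- by move=> y i Ty; apply: MP; exists y.
- move=> O y oO Ty Oy.
  have oO' : open (@chart R T f @^-1` O).
    by apply: open_comp => // p _; exact: continuous_chart.
  have clT : closure (freg f)° y by rewrite (freg_regular hT).
  have [x [xT xO]] := clT _ (open_nbhs_nbhs (conj oO' Oy)).
  have oB : open ((freg f)° `&` @chart R T f @^-1` O).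
    by apply: openI => //; exact: open_interior.
  exists ((freg f)° `&` @chart R T f @^-1` O); split.
  + exact: open_measurable2.
  + by move=> p [/interior_subset].
  + by move=> p [].
  + exact: (open_measure2_gt0 (x := x)).
Qed.

Lemma dot_ge0 (u : 'rV[R]_3) : 0 <= dot u u.
Proof. by apply: sumr_ge0 => i _; rewrite -expr2 sqr_ge0. Qed.

Lemma dot_eq0 (u : 'rV[R]_3) : dot u u = 0 -> u = 0.
Proof.
move=> /eqP; rewrite psumr_eq0 => [/allP u0|i _]; last first.
  by rewrite -expr2 sqr_ge0.
apply/rowP => i; rewrite mxE; have := u0 i (mem_index_enum _).
by rewrite -expr2 sqrf_eq0 => /eqP.
Qed.

Lemma elen_gt0 e : 0 < @elen R T e.
Proof.
rewrite sqrtr_gt0 lt_neqAle dot_ge0 andbT eq_sym; apply/eqP => /dot_eq0 /eqP.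
rewrite subr_eq0 => /eqP /(vpos_inj hT) /eqP.
by rewrite eq_sym (negbTE (ends_neq hT e)).
Qed.

Lemma etan_unit e : dot (@etan R T e) (etan e) = 1.
Proof.
have e0 := elen_gt0 e.
have -> : dot (etan e) (etan e) = (elen e)^-1 ^+ 2 * dot (evec e) (evec e).
  by rewrite /dot mulr_sumr; apply: eq_bigr => i _; rewrite !mxE; ring.
rewrite -(sqr_sqrtr (dot_ge0 (evec e))) -/(elen e) -exprMn mulVf ?expr1n //.
by rewrite gt_eqF.
Qed.

Lemma evecE e : @evec R T e = elen e *: etan e.
Proof. by rewrite scalerA divff ?scale1r // gt_eqF // elen_gt0. Qed.

(** Passes from the parameter interval [0, 1] of [eset] to the arc length used by [intE]. *)
Lemma esetE e : @eset R T e =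
  (fun s : R => vpos (etail e) + s *: etan e) @` `[0, elen e].
Proof.
have e0 := elen_gt0 e.
apply/seteqP; split => [_ [s /= sI <-]|_ [s /= sI <-]].
  exists (s * elen e); last by rewrite evecE scalerA.
  move: sI; rewrite /= !in_itv /= => /andP[s0 s1].
  by rewrite mulr_ge0 ?ler_piMl // ltW.
exists (s / elen e); last by rewrite evecE scalerA divfK // gt_eqF.
move: sI; rewrite /= !in_itv /= => /andP[s0 s1].
by rewrite ler_pdivrMr // mul1r s1 andbT; apply: divr_ge0 => //; exact: ltW.
Qed.

Lemma continuous_line (a v : 'rV[R]_3) : continuous (fun s : R => a + s *: v).
Proof.
by move=> s; apply: cvgD; [exact: cvg_cst|apply: cvgZr_tmp; exact: cvg_id].
Qed.

Lemma eset_compact e : compact (@eset R T e).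
Proof.
apply: continuous_compact; last exact: segment_compact.
by apply: continuous_subspaceT; exact: continuous_line.
Qed.

Lemma itv_measure_lty (a b : R) :
  (lebesgue_measure (`[a, b]%classic : set R) < +oo)%E.
Proof. by rewrite lebesgue_measure_itv; case: ifP => _; rewrite ltry. Qed.

Lemma itv_measure_gt0 (a b : R) : a < b ->
  (0 < lebesgue_measure (`]a, b[%classic : set R))%E.
Proof.
by move=> ab; rewrite lebesgue_measure_itv /= lte_fin ab lte_fin subr_gt0.
Qed.

Lemma measurable_line (a v : 'rV[R]_3) i :
  measurable_fun setT (fun s : R => (a + s *: v) 0 i).
Proof.
under eq_fun do rewrite !mxE.
by apply: measurable_funD => //; exact: measurable_funM.
Qed.

Lemma integral_on_edge e :
  integral_on (@eset R T e) (fun p => intE e (peval p)).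
Proof.
have [M MP] := compact_coord_bound (@eset_compact e).
rewrite esetE; apply: (integral_on_image (M := M)
  (mu := @lebesgue_measure R)) => //.
- exact: itv_measure_lty.
- by move=> i; apply: measurable_funTS; exact: measurable_line.
- by move=> s i sI; apply: MP; rewrite esetE; exists s.
- move=> O s oO sI Os; have e0 := elen_gt0 e.
  have /nbhs_ballP [r /= r0 rO] :
      nbhs s [set u : R | O (vpos (etail e) + u *: etan e)].
    by apply: continuous_line; exact: open_nbhs_nbhs.
  move: sI; rewrite /= in_itv /= => /andP[s0 s1].
  exists `]Num.max 0 (s - r), Num.min (elen e) (s + r)[%classic; split => //.
  + move=> u /=; rewrite !in_itv /= lt_min gt_max.
    by move=> /andP[/andP[? _] /andP[? _]]; rewrite !ltW.
  + move=> u /=; rewrite in_itv /= lt_min gt_max.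
    move=> /andP[/andP[_ ?] /andP[_ ?]].
    by apply: rO; rewrite /ball /= ltr_distlC; apply/andP; split; lra.
  + apply: itv_measure_gt0.
    by rewrite lt_min !gt_max e0 /=; do ?[apply/andP; split]; lra.
Qed.

End Charts.

(** * Riesz representation for polynomials restricted to a set *)

(** The Fredholm alternative: a row lies in the row space of a matrix as soon as it annihilates the
    kernel. Invertibility cannot be assumed, because monomials become linearly dependent on a face
    or an edge. *)
Lemma gram_solve (R : fieldType) (J : finType) (G : J -> J -> R) (l : J -> R) :
  (forall c, (forall a, \sum_b G a b * c b = 0) -> \sum_b l b * c b = 0) ->
  exists c, forall b, \sum_a c a * G a b = l b.
Proof.
move=> Gl.
pose M := \matrix_(a < #|J|, b < #|J|) G (enum_val a) (enum_val b).
pose L := \row_(b < #|J|) l (enum_val b).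
have reidx (F : J -> R) : \sum_b F b = \sum_(b < #|J|) F (enum_val b).
  by rewrite (reindex _ (onW_bij _ (enum_val_bij J))).
have /submxP [c cE] : (L <= M)%MS.
  rewrite submxE; apply/eqP/rowP => k; rewrite !mxE.
  have /matrixP Mk := mulmx_coker M.
  rewrite -[RHS](Gl (fun b => cokermx M (enum_rank b) k)).
    by rewrite reidx; apply: eq_bigr => b _; rewrite [L _ _]mxE enum_valK.
  move=> a; have := Mk (enum_rank a) k; rewrite !mxE => Ea.
  rewrite -[RHS]Ea reidx.
  by apply: eq_bigr => b _; rewrite [M _ _]mxE enum_rankK enum_valK.
exists (fun a => c 0 (enum_rank a)) => b.
have /rowP /(_ (enum_rank b)) := cE; rewrite !mxE enum_rankK => ->.
rewrite [LHS]reidx.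
by apply: eq_bigr => a _; rewrite [M _ _]mxE enum_rankK enum_valK.
Qed.

Section Riesz.
Variable R : realType.
Local Notation poly3 := (mpoly 3 R).
Variables (D : set 'rV[R]_3) (I : poly3 -> R).
Hypothesis hI : integral_on D I.

Lemma integral_on0 : I 0 = 0.
Proof.
have := integral_on_linear hI (-1) 0 0.
by rewrite scaler0 addr0 mulN1r addNr.
Qed.

Lemma integral_onD p q : I (p + q) = I p + I q.
Proof. by have := integral_on_linear hI 1 p q; rewrite scale1r mul1r. Qed.

Lemma integral_onZ c p : I (c *: p) = c * I p.
Proof.
by have := integral_on_linear hI c p 0; rewrite !addr0 integral_on0 addr0.
Qed.

Lemma integral_on_sum (J : Type) (s : seq J) (P : pred J) F :
  I (\sum_(i <- s | P i) F i) = \sum_(i <- s | P i) I (F i).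
Proof. by apply: (big_morph I integral_onD integral_on0). Qed.

Variable k : nat.
Implicit Types p q : 'rV[poly3]_k.

Definition pdot p q : poly3 := \sum_i p 0 i * q 0 i.

Lemma integral_pdot_eq0 p : I (pdot p p) = 0 ->
  forall i x, D x -> peval (p 0 i) x = 0.
Proof.
move=> Ip i x Dx.
have pE y : peval (pdot p p) y = \sum_i peval (p 0 i) y ^+ 2.
  rewrite /peval /pdot raddf_sum; apply: eq_bigr => j _.
  by rewrite [LHS]mevalM expr2.
have p0 y : D y -> 0 <= peval (pdot p p) y.
  by move=> _; rewrite pE; apply: sumr_ge0 => j _; exact: sqr_ge0.
have /eqP := integral_on_definite hI p0 Ip Dx.
rewrite pE psumr_eq0 => [|j _]; last exact: sqr_ge0.
by move=> /allP /(_ i (mem_index_enum _)); rewrite sqrf_eq0 => /eqP.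
Qed.

(** A vector in the kernel of the Gram matrix gives a field with zero square integral; it vanishes
    on [D] by definiteness, and [L] sends it to 0 by the second hypothesis. Scalars appear as
    constant polynomials because the rows form a module over [poly3]. The length [k] is 3 on the
    solid, 2 on a face and 1 on an edge. *)
Lemma riesz (j : nat) (L : 'rV[poly3]_k -> R) :
  (forall c p q, L (mpolyC 3 c *: p + q) = c * L p + L q) ->
  (forall p, (forall i x, D x -> peval (p 0 i) x = 0) -> L p = 0) ->
  exists2 u : 'rV[poly3]_k, (forall i, degle j (u 0 i)) &
    forall p, (forall i, degle j (p 0 i)) -> I (pdot u p) = L p.
Proof.
move=> Llin L0.
have LD p q : L (p + q) = L p + L q.
  by rewrite -[p]scale1r -(mpolyC1 3 R) Llin mul1r mpolyC1 !scale1r.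
have L00 : L 0 = 0 by have := Llin (-1) 0 0; rewrite scaler0 addr0 mulN1r addNr.
have LZ c p : L (mpolyC 3 c *: p) = c * L p.
  by have := Llin c p 0; rewrite !addr0 L00 addr0.
(* The spanning family consists of the coordinate vectors times the monomials of degree at most [j];
   the bound in [bmultinom] is strict. *)
pose J := ('I_k * bmultinom 3 j.+1)%type.
pose b (a : J) : 'rV[poly3]_k := mpolyX R a.2 *: delta_mx 0 a.1.
pose e (c : J -> R) := \sum_a mpolyC 3 (c a) *: b a.
have eE c i : e c 0 i = \sum_(m : bmultinom 3 j.+1) c (i, m) *: mpolyX R m.
  pose F i' m := (mpolyC 3 (c (i', m)) *: b (i', m)) 0 i.
  rewrite /e summxE (eq_bigr (fun a => F a.1 a.2)) => [|[] //].
  rewrite -(pair_bigA _ F) /= /F /b /=.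
  rewrite (bigD1 i) //= [X in _ + X]big1 ?addr0.
    by apply: eq_bigr => m _; rewrite !mxE !eqxx /= mulr1 mul_mpolyC.
  move=> i' i'i; apply: big1 => m _.
  by rewrite !mxE eqxx eq_sym (negbTE i'i) /= !mulr0.
have edeg c i : degle j (e c 0 i).
  rewrite eE; apply: (leq_trans (mmeasure_sum _ _ _ _)).
  apply/bigmax_leqP => m _; apply: (leq_trans (msizeZ_le _ _)).
  by rewrite msizeX bmdeg.
have espan p : (forall i, degle j (p 0 i)) ->
    p = e (fun a => mcoeff (bmnm a.2) (p 0 a.1)).
  move=> pj; apply/rowP => i; rewrite eE /=; apply: mpolywE; exact: pj.
have pdotZl c p q : pdot (mpolyC 3 c *: p) q = c *: pdot p q.
  rewrite /pdot scaler_sumr; apply: eq_bigr => i _.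
  by rewrite mxE -mulrA mul_mpolyC.
have pdotC p q : pdot p q = pdot q p by apply: eq_bigr => i _; rewrite mulrC.
have pdot_suml c q : pdot (e c) q = \sum_a c a *: pdot (b a) q.
  transitivity (\sum_i \sum_a (mpolyC 3 (c a) *: b a) 0 i * q 0 i).
    by apply: eq_bigr => i _; rewrite summxE mulr_suml.
  by rewrite exchange_big; apply: eq_bigr => a _; rewrite -pdotZl.
have Ie c q : I (pdot (e c) q) = \sum_a c a * I (pdot (b a) q).
  rewrite pdot_suml integral_on_sum.
  by apply: eq_bigr => a _; rewrite integral_onZ.
have Le c : L (e c) = \sum_a c a * L (b a).
  rewrite /e (big_morph L LD L00); apply: eq_bigr => a _; exact: LZ.
have [c0 c0E] : exists c0, forall b',
    \sum_a c0 a * I (pdot (b a) (b b')) = L (b b').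
  apply: gram_solve => c Gc.
  have Gc' a : I (pdot (b a) (e c)) = 0.
    rewrite pdotC Ie -[RHS](Gc a); apply: eq_bigr => a' _.
    by rewrite mulrC pdotC.
  rewrite -[RHS](L0 (e c)) ?Le.
    by apply: eq_bigr => a _; rewrite mulrC.
  apply: integral_pdot_eq0; rewrite Ie big1 // => a _.
  by rewrite Gc' mulr0.
exists (e c0) => [i|p /espan ->]; first exact: edeg.
rewrite Le pdotC Ie; apply: eq_bigr => a _; rewrite -c0E -Ie; congr (_ * I _).
exact: pdotC.
Qed.
End Riesz.

(** * Tangential derivatives *)

Section Lines.
Variable R : realType.
Local Notation poly3 := (mpoly 3 R).
Implicit Types (p : poly3) (x d : 'rV[R]_3).

(** Restricting to a line turns directional derivatives into formal derivatives in one variable, so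
    that vanishing is settled by counting roots. *)
Lemma line_poly p x d : exists q : {poly R},
  (forall s, q.[s] = peval p (x + s *: d)) /\
  (forall s, q^`().[s] = dot (veval (grad p) (x + s *: d)) d).
Proof.
have dotE p' s : dot (veval (grad p') (x + s *: d)) d =
    \sum_i peval (mderiv i p') (x + s *: d) * d 0 i.
  by apply: eq_bigr => i _; rewrite !mxE.
elim/mpoly_ring_ind: p => [c|i|p p' [q [qE dE]] [q' [qE' dE']]
    |p p' [q [qE dE]] [q' [qE' dE']]].
- exists c%:P; split => s; first by rewrite hornerC pevalC.
  rewrite derivC horner0 dotE big1 // => i _.
  by rewrite mderivC /peval meval0 mul0r.
- exists ((x 0 i)%:P + (d 0 i)%:P * 'X); split => s.
    by rewrite pevalX !hornerE !mxE mulrC.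
  rewrite derivD derivC add0r derivM derivC mul0r add0r derivX mulr1 hornerC.
  rewrite dotE (bigD1 i) //= big1 => [|j ji].
    rewrite mderivX mnm1E eqxx scale1r.
    rewrite (_ : mnm_sub (mnm1 i) (mnm1 i) = mnm0) ?mpolyX0 ?addr0.
      by rewrite /peval meval1 mul1r.
    by apply/mnmP => k; rewrite mnmBE subnn mnm0E.
  by rewrite mderivX mnm1E eq_sym (negbTE ji) scale0r /peval meval0 mul0r.
- exists (q + q'); split => s; first by rewrite hornerD pevalD qE qE'.
  rewrite derivD hornerD dE dE' !dotE -big_split; apply: eq_bigr => i _.
  by rewrite mderivD pevalD mulrDl.
- exists (q * q'); split => s; first by rewrite hornerM pevalM qE qE'.
  rewrite derivM hornerD !hornerM dE dE' !dotE qE qE' mulr_suml mulr_sumr.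
  rewrite -big_split; apply: eq_bigr => i _.
  by rewrite mderivM pevalD !pevalM mulrDl; congr (_ + _); ring.
Qed.

Lemma poly_eq0_itv (q : {poly R}) a b : a < b ->
  (forall s, a < s < b -> q.[s] = 0) -> q = 0.
Proof.
move=> ab q0; apply/eqP; apply: contraT => qn0.
(* Distinct points of the open interval; with [k.+2] the fraction is at most one half, which keeps
   them away from [b]. There are [size q] of them, more than a nonzero [q] can have as roots. *)
pose r (k : nat) := a + (b - a) / k.+2%:R.
have : (size [seq r k | k <- iota 0 (size q)] < size q)%N.
  apply: max_poly_roots => //.
    apply/allP => _ /mapP[k _ ->]; rewrite rootE q0 //; apply/andP; split.
      by rewrite ltrDl divr_gt0 // subr_gt0.
    rewrite -ltrBrDl ltr_pdivrMr // ltr_pMr ?subr_gt0 //.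
    by rewrite (ltr_nat _ 1).
  rewrite map_inj_uniq ?iota_uniq // => k l /addrI.
  have ba : b - a != 0 by rewrite gt_eqF // subr_gt0.
  by move=> /(mulfI ba) /invr_inj /eqP; rewrite eqr_nat => /eqP [].
by rewrite size_map size_iota ltnn.
Qed.

(** The restriction to the line is the zero polynomial, so the conclusion also covers the end points
    of the interval. *)
Lemma deriv_line_eq0 p x d a b : a < b ->
  (forall s, a < s < b -> peval p (x + s *: d) = 0) ->
  forall s, dot (veval (grad p) (x + s *: d)) d = 0.
Proof.
move=> ab p0 s; have [q [qE <-]] := line_poly p x d.
rewrite (poly_eq0_itv (q := q) ab) ?deriv0 ?horner0 // => u uab.
by rewrite qE p0.
Qed.

Lemma vanish_closure (f : 'rV[R]_3 -> R) (A : set 'rV[R]_3) :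
  continuous f -> (forall x, A x -> f x = 0) ->
  forall x, closure A x -> f x = 0.
Proof.
move=> cf f0 x clx.
have cl : closed (f @^-1` [set 0]).
  by apply: closed_comp => [y _|]; [exact: cf|exact: closed_eq].
have : closure (f @^-1` [set 0]) x by apply: closureS clx => y /f0.
by move/closure_id: cl => <-.
Qed.

Lemma continuous_dot_veval (q : 'rV[poly3]_3) (d : 'rV[R]_3) :
  continuous (fun x => dot (veval q x) d).
Proof.
have E x : dot (veval q x) d = peval (\sum_i q 0 i * mpolyC 3 (d 0 i)) x.
  rewrite /peval raddf_sum; apply: eq_bigr => i _.
  by rewrite mxE [RHS]mevalM mevalC.
rewrite (funext E); exact: continuous_peval.
Qed.

End Lines.

(** * Vector algebra in dimension three *)

Section Vectors.
Variable A : comNzRingType.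
Implicit Types u v w : 'rV[A]_3.

Lemma dotE u v : dot u v = u 0 0 * v 0 0 + u 0 1 * v 0 1 + u 0 2 * v 0 2.
Proof.
rewrite /dot !big_ord_recr big_ord0 /= add0r.
by congr (u 0 _ * v 0 _ + u 0 _ * v 0 _ + u 0 _ * v 0 _); exact: val_inj.
Qed.

Lemma cross0E u v : cross u v 0 0 = u 0 1 * v 0 2 - u 0 2 * v 0 1.
Proof.
by rewrite mxE; congr (u 0 _ * v 0 _ - u 0 _ * v 0 _); exact: val_inj.
Qed.

Lemma cross1E u v : cross u v 0 1 = u 0 2 * v 0 0 - u 0 0 * v 0 2.
Proof.
by rewrite mxE; congr (u 0 _ * v 0 _ - u 0 _ * v 0 _); exact: val_inj.
Qed.

Lemma cross2E u v : cross u v 0 2 = u 0 0 * v 0 1 - u 0 1 * v 0 0.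
Proof.
by rewrite mxE; congr (u 0 _ * v 0 _ - u 0 _ * v 0 _); exact: val_inj.
Qed.

Lemma row3P u v : u 0 0 = v 0 0 -> u 0 1 = v 0 1 -> u 0 2 = v 0 2 -> u = v.
Proof.
move=> uv0 uv1 uv2; apply/rowP => -[[|[|[|//]]] H].
- by rewrite (_ : Ordinal H = 0) //; exact: val_inj.
- by rewrite (_ : Ordinal H = 1) //; exact: val_inj.
- by rewrite (_ : Ordinal H = 2) //; exact: val_inj.
Qed.

Lemma dotC u v : dot u v = dot v u.
Proof. by rewrite !dotE; ring. Qed.

Lemma dotDl u v w : dot (u + v) w = dot u w + dot v w.
Proof. by rewrite !dotE !mxE; ring. Qed.

Lemma dotZl c u w : dot (c *: u) w = c * dot u w.
Proof. by rewrite !dotE !mxE; ring. Qed.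

Lemma dotNl u w : dot (- u) w = - dot u w.
Proof. by rewrite -scaleN1r dotZl mulN1r. Qed.

Lemma dot0l w : dot 0 w = 0.
Proof. by rewrite -(scale0r 0) dotZl mul0r. Qed.

Lemma dotDr u v w : dot w (u + v) = dot w u + dot w v.
Proof. by rewrite ![dot w _]dotC dotDl. Qed.

Lemma dotZr c u w : dot w (c *: u) = c * dot w u.
Proof. by rewrite ![dot w _]dotC dotZl. Qed.

Lemma dotNr u w : dot w (- u) = - dot w u.
Proof. by rewrite ![dot w _]dotC dotNl. Qed.

Lemma crossC u v : cross u v = - cross v u.
Proof. by apply: row3P; rewrite [RHS]mxE !(cross0E, cross1E, cross2E); ring. Qed.

Lemma crossDl u v w : cross (u + v) w = cross u w + cross v w.
Proof.
by apply: row3P; rewrite [RHS]mxE !(cross0E, cross1E, cross2E) !mxE; ring.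
Qed.

Lemma crossZl c u w : cross (c *: u) w = c *: cross u w.
Proof.
by apply: row3P; rewrite [RHS]mxE !(cross0E, cross1E, cross2E) !mxE; ring.
Qed.

Lemma crossNl u w : cross (- u) w = - cross u w.
Proof. by rewrite -scaleN1r crossZl scaleN1r. Qed.

Lemma crossDr u v w : cross w (u + v) = cross w u + cross w v.
Proof. by rewrite ![cross w _]crossC crossDl opprD. Qed.

Lemma crossZr c u w : cross w (c *: u) = c *: cross w u.
Proof. by rewrite ![cross w _]crossC crossZl scalerN. Qed.

Lemma crossvv u : cross u u = 0.
Proof. by apply: row3P; rewrite [RHS]mxE !(cross0E, cross1E, cross2E); ring. Qed.

Lemma dot_cross u v w : dot (cross u v) w = dot u (cross v w).
Proof. by rewrite !dotE !(cross0E, cross1E, cross2E); ring. Qed.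

Lemma dot_crossl u v : dot (cross u v) u = 0.
Proof. by rewrite !dotE !(cross0E, cross1E, cross2E); ring. Qed.

Lemma dot_crossr u v : dot (cross u v) v = 0.
Proof. by rewrite dot_cross crossvv dotC dot0l. Qed.

Lemma crosslA u v w : cross (cross u v) w = dot u w *: v - dot v w *: u.
Proof.
by apply: row3P; rewrite [RHS]mxE !(cross0E, cross1E, cross2E) !mxE !dotE; ring.
Qed.

Lemma crossrA u v w : cross u (cross v w) = dot u w *: v - dot u v *: w.
Proof. by rewrite crossC crosslA opprB ![dot _ u]dotC. Qed.

(** The Binet-Cauchy identity. *)
Lemma dot_cross_cross (a b c d : 'rV[A]_3) :
  dot (cross a b) (cross c d) = dot a c * dot b d - dot a d * dot b c.
Proof. by rewrite !dotE !(cross0E, cross1E, cross2E); ring. Qed.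

(** With [w] the cross product of [a] and [b], expanding the triple product (v x w) x w in two ways
    gives the decomposition. *)
Lemma frame_cross (a b v : 'rV[A]_3) :
  dot a a = 1 -> dot b b = 1 -> dot a b = 0 ->
  v = dot v a *: a + dot v b *: b + dot v (cross a b) *: cross a b.
Proof.
move=> aa bb ab; set w := cross a b.
have aw : cross a w = - b by rewrite crossrA ab aa scale0r scale1r sub0r.
have bw : cross b w = a.
  by rewrite crossrA bb [dot b a]dotC ab scale0r scale1r subr0.
have ww : dot w w = 1.
  by rewrite dot_cross_cross aa bb [dot b a]dotC ab !mulr1 mul0r subr0.
have := crosslA v w w.
rewrite {1}/w crossrA crossDl crossNl !crossZl -/w aw bw ww scale1r scalerN.
move=> E; have -> : dot v w *: w = v + (- (dot v b *: b) - dot v a *: a).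
  by rewrite E addrC subrK.
by rewrite -opprD [X in _ - X]addrC [RHS]addrC subrK.
Qed.

End Vectors.

Section Frame.
Variable F : fieldType.
Variables a b n : 'rV[F]_3.
Hypothesis unitF : [/\ dot a a = 1, dot b b = 1 & dot n n = 1].
Hypothesis orthF : [/\ dot a b = 0, dot a n = 0 & dot b n = 0].

(** The frame of a face may have either orientation: [n] is the cross product of [a] and [b] up to a
    sign, which cancels because [n] occurs twice. *)
Lemma frame_dec v : v = dot v a *: a + dot v b *: b + dot v n *: n.
Proof.
have [aa bb nn] := unitF; have [ab an bn] := orthF.
rewrite {1}(frame_cross v aa bb ab); congr (_ + _).
have nE : n = dot n (cross a b) *: cross a b.
  rewrite {1}(frame_cross n aa bb ab) ![dot n _]dotC an bn.
  by rewrite !scale0r !add0r dotC.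
set c := dot n (cross a b) in nE.
have c2 : c * c = 1 by rewrite -[RHS]nn {2}nE dotZr.
by rewrite nE dotZr scalerA mulrAC c2 mul1r.
Qed.

End Frame.

Lemma sum_ord3 (V : nmodType) (F : 'I_3 -> V) : \sum_i F i = F 0 + F 1 + F 2.
Proof.
rewrite !big_ord_recr big_ord0 /= add0r.
by congr (F _ + F _ + F _); exact: val_inj.
Qed.

(** * Polynomial vector fields and their components *)

Section Fields.
Variable R : realType.
Local Notation poly3 := (mpoly 3 R).
Implicit Types (p q : poly3) (P Q : 'rV[poly3]_3) (c : 'rV[R]_3) (x : 'rV[R]_3).

(** A component of a field in a fixed direction, kept as a polynomial so that [integral_on] and the
    degree bounds apply to it. *)
Definition cdot P c : poly3 := \sum_i c 0 i *: P 0 i.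

Definition tangential f1 f2 p q : 'rV[poly3]_3 :=
  \row_(i < 3) ((f1 : 'rV[R]_3) 0 i *: p + (f2 : 'rV[R]_3) 0 i *: q).

Lemma pevalB p q x : peval (p - q) x = peval p x - peval q x.
Proof. exact: mevalB. Qed.

Lemma peval0 x : peval (0 : poly3) x = 0.
Proof. exact: meval0. Qed.

Lemma peval_sum (J : Type) (s : seq J) (B : pred J) (F : J -> poly3) x :
  peval (\sum_(i <- s | B i) F i) x = \sum_(i <- s | B i) peval (F i) x.
Proof. exact: raddf_sum. Qed.

Lemma peval_cdot P c x : peval (cdot P c) x = dot (veval P x) c.
Proof.
by rewrite peval_sum; apply: eq_bigr => i _; rewrite pevalZ mxE mulrC.
Qed.

Lemma cdot_linear a P Q c :
  cdot (mpolyC 3 a *: P + Q) c = a *: cdot P c + cdot Q c.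
Proof.
rewrite /cdot scaler_sumr -big_split; apply: eq_bigr => i _ /=.
by rewrite !mxE mul_mpolyC scalerDr !scalerA mulrC.
Qed.

Lemma div_linear a P Q : div (mpolyC 3 a *: P + Q) = a *: div P + div Q.
Proof.
rewrite /div scaler_sumr -big_split; apply: eq_bigr => i _ /=.
by rewrite !mxE mul_mpolyC mderivD mderivZ.
Qed.

Lemma curl_linear a P Q :
  curl (mpolyC 3 a *: P + Q) = mpolyC 3 a *: curl P + curl Q.
Proof.
apply/rowP => i; rewrite !mxE !mul_mpolyC !mderivD !mderivZ scalerBr.
by rewrite opprD addrACA.
Qed.

Lemma grad_linear a p q : grad (a *: p + q) = mpolyC 3 a *: grad p + grad q.
Proof. by apply/rowP => i; rewrite !mxE mderivD mderivZ mul_mpolyC. Qed.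

Lemma div_curl P : div (curl P) = 0.
Proof.
rewrite /div !big_ord_recr big_ord0 /= add0r !mxE !mderivB.
set i0 := widen_ord _ _; set i1 := widen_ord _ _; set i2 := ord_max.
have -> : i0 + 1 = i1 by exact: val_inj.
have -> : i0 + 2 = i2 by exact: val_inj.
have -> : i1 + 1 = i2 by exact: val_inj.
have -> : i1 + 2 = i0 by exact: val_inj.
have -> : i2 + 1 = i0 by exact: val_inj.
have -> : i2 + 2 = i1 by exact: val_inj.
rewrite (mderiv_comm i1 i0) (mderiv_comm i2 i0) (mderiv_comm i2 i1).
ring.
Qed.

Lemma curl_grad p : curl (grad p) = 0.
Proof. by apply/rowP => i; rewrite !mxE mderiv_comm subrr. Qed.

Lemma degle_sum j (J : Type) (s : seq J) (B : pred J) (F : J -> poly3) :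
  (forall i, B i -> degle j (F i)) -> degle j (\sum_(i <- s | B i) F i).
Proof.
move=> Fj; apply: (big_ind (degle j)) => //.
  by rewrite /degle msize0.
move=> p q pj qj.
by rewrite /degle (leq_trans (mmeasureD_le _ _ _)) // geq_max pj.
Qed.

Lemma degleZ j a p : degle j p -> degle j (a *: p).
Proof. by move=> pj; exact: leq_trans (msizeZ_le _ _) pj. Qed.

Lemma degleB j p q : degle j p -> degle j q -> degle j (p - q).
Proof.
move=> pj qj; rewrite -scaleN1r /degle (leq_trans (mmeasureD_le _ _ _)) //.
by rewrite geq_max pj /=; exact: degleZ.
Qed.

Lemma degle_leq j k p : (j <= k)%N -> degle j p -> degle k p.
Proof. by move=> jk pj; rewrite /degle (leq_trans pj). Qed.

Lemma degle_mderiv j i p : degle j p -> degle j (mderiv i p).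
Proof.
move=> pj; rewrite (mderivwE i pj); apply: degle_sum => m _; apply: degleZ.
rewrite /degle msizeX ltnS; apply: (@leq_trans (mdeg m)); last first.
  by rewrite -ltnS bmdeg.
by rewrite !mdegE; apply: leq_sum => k _; rewrite mnmBE leq_subr.
Qed.

Lemma vdegle_curl j P : vdegle j P -> vdegle j (curl P).
Proof. by move=> Pj i; rewrite mxE; apply: degleB; exact: degle_mderiv. Qed.

Lemma vdegle_grad j p : degle j p -> vdegle j (grad p).
Proof. by move=> pj i; rewrite mxE; exact: degle_mderiv. Qed.

Lemma degle_cdot j P c : vdegle j P -> degle j (cdot P c).
Proof. by move=> Pj; apply: degle_sum => i _; exact: degleZ. Qed.

Lemma tangential_linear f1 f2 a p q p' q' :
  tangential f1 f2 (a *: p + p') (a *: q + q') =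
  mpolyC 3 a *: tangential f1 f2 p q + tangential f1 f2 p' q'.
Proof.
apply/rowP => i; rewrite !mxE mul_mpolyC !scalerDr !scalerA.
by rewrite addrACA ![a * _]mulrC.
Qed.

Lemma veval_tangential f1 f2 p q x :
  veval (tangential f1 f2 p q) x = peval p x *: f1 + peval q x *: f2.
Proof.
by apply/rowP => i; rewrite !mxE pevalD !pevalZ mulrC [X in _ + X]mulrC.
Qed.

Section FrameFields.
Variables f1 f2 n : 'rV[R]_3.
Hypothesis unitF : [/\ dot f1 f1 = 1, dot f2 f2 = 1 & dot n n = 1].
Hypothesis orthF : [/\ dot f1 f2 = 0, dot f1 n = 0 & dot f2 n = 0].

(** The curl is the sum of grad(P.c) x c over an orthonormal frame, and the term with c = n is
    orthogonal to n. The normal component of the curl thus involves only tangential derivatives of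
    tangential components. *)
Lemma dot_curl_frame P x : dot (veval (curl P) x) n =
  dot (veval (grad (cdot P f1)) x) (cross f1 n) +
  dot (veval (grad (cdot P f2)) x) (cross f2 n).
Proof.
have gradE c : veval (grad (cdot P c)) x =
    \row_i \sum_j c 0 j * peval (mderiv i (P 0 j)) x.
  apply/rowP => i; rewrite !mxE /cdot raddf_sum peval_sum.
  apply: eq_bigr => j _.
  by rewrite /= mderivZ pevalZ.
have delta (i j : 'I_3) :
    (i == j)%:R = f1 0 i * f1 0 j + f2 0 i * f2 0 j + n 0 i * n 0 j :> R.
  have dd c : dot (delta_mx 0 j) c = c 0 j.
    rewrite /dot (bigD1 j) //= big1 => [|k kj]; rewrite !mxE eqxx.
      by rewrite eqxx mul1r addr0.
    by rewrite (negbTE kj) mul0r.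
  have /rowP /(_ i) := frame_dec unitF orthF (delta_mx 0 j).
  by rewrite !dd !mxE eqxx /= => ->; ring.
have H (i j : 'I_3) :
    f1 0 i * f1 0 j + f2 0 i * f2 0 j = (i == j)%:R - n 0 i * n 0 j.
  by rewrite delta addrK.
pose D i j := peval (mderiv i (P 0 j)) x.
have cE : [/\ veval (curl P) x 0 0 = D 1 2 - D 2 1,
    veval (curl P) x 0 1 = D 2 0 - D 0 2 &
    veval (curl P) x 0 2 = D 0 1 - D 1 0].
  by rewrite !mxE !pevalB /D; split; congr (peval (mderiv _ (P 0 _)) x
    - peval (mderiv _ (P 0 _)) x); exact: val_inj.
have [c0 c1 c2] := cE.
have gE c i : veval (grad (cdot P c)) x 0 i =
    c 0 0 * D i 0 + c 0 1 * D i 1 + c 0 2 * D i 2.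
  by rewrite gradE mxE sum_ord3.
(* [g] is the projection onto the plane of the face. Replacing it by the identity minus the
   projection onto [n], the part from [n] cancels and leaves the curl. *)
pose g i j := f1 0 i * f1 0 j + f2 0 i * f2 0 j.
transitivity (\sum_i (D 0 i * (g i 1 * n 0 2 - g i 2 * n 0 1) +
    D 1 i * (g i 2 * n 0 0 - g i 0 * n 0 2) +
    D 2 i * (g i 0 * n 0 1 - g i 1 * n 0 0))).
  rewrite sum_ord3 dotE c0 c1 c2 /g !H /=; ring.
rewrite sum_ord3 /g !dotE !gE !(cross0E, cross1E, cross2E); ring.
Qed.

End FrameFields.
End Fields.

Lemma near_line (R : realType) (V : normedModType R) (x d : V) (U : set V) :
  nbhs x U -> exists2 r, 0 < r & forall s : R, - r < s < r -> U (x + s *: d).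
Proof.
move=> xU.
have c0 : (fun s : R => x + s *: d) s @[s --> (0 : R)] --> x + 0 *: d.
  by apply: cvgD; [exact: cvg_cst|apply: cvgZr_tmp; exact: cvg_id].
rewrite scale0r addr0 in c0.
have /nbhs_ballP [r /= r0 rU] := c0 _ xU.
by exists r => // s sr; apply: rU; rewrite /ball /= sub0r normrN ltr_norml.
Qed.

Lemma cdot_tangential (R : realType) (f1 f2 c : 'rV[R]_3) (p q : mpoly 3 R) :
  cdot (tangential f1 f2 p q) c = dot f1 c *: p + dot f2 c *: q.
Proof.
rewrite /cdot /dot !scaler_suml -big_split; apply: eq_bigr => i _ /=.
by rewrite mxE scalerDr !scalerA [c 0 i * _]mulrC [c 0 i * f2 0 i]mulrC.
Qed.

(** * Existence of the weak gradients *)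

Lemma opp_add_linear (A : comNzRingType) (c x x' y y' : A) :
  - (c * x + x') + (c * y + y') = c * (- x + y) + (- x' + y').
Proof. by ring. Qed.

Section WeakGradient.
Variables (R : realType) (T : solid_complex R).
Hypothesis hT : is_polyhedron T.
Local Notation poly3 := (mpoly 3 R).
Implicit Types (f : face T) (e : edge T) (p q : poly3) (x : 'rV[R]_3)
  (P Q : 'rV[poly3]_3).
Variables (n : face T -> 'rV[R]_3) (t : face T -> edge T -> 'rV[R]_3).

Lemma intT_ext (g h : 'rV[R]_3 -> R) :
  (forall x, solid T x -> g x = h x) -> intT T g = intT T h.
Proof. by move=> gh; apply: eq_Rintegral => p /[!inE] pT; exact: gh. Qed.

Lemma intF_ext f (g h : 'rV[R]_3 -> R) :
  (forall x, fset f x -> g x = h x) -> intF f g = intF f h.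
Proof.
by move=> gh; apply: eq_Rintegral => p /[!inE] pf; apply: gh; exists p.
Qed.

Lemma intE_ext e (g h : 'rV[R]_3 -> R) :
  (forall x, eset e x -> g x = h x) -> intE e g = intE e h.
Proof.
move=> gh; apply: eq_Rintegral => s /[!inE] se; apply: gh.
by rewrite esetE //; exists s.
Qed.

Lemma Pspace_poly j (D : set 'rV[R]_3) (g : 'rV[R]_3 -> R) : Pspace j D g ->
  exists p, [/\ degle j p, (forall x, D x -> g x = peval p x) &
    forall x, ~ D x -> g x = 0].
Proof.
move=> [p pj ->]; exists p; split => // x Dx; rewrite patchE.
  by rewrite mem_set.
by rewrite memNset.
Qed.

Lemma Pspace_patch j (D : set 'rV[R]_3) p : degle j p ->
  Pspace j D (patch (fun=> 0) D (peval p)).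
Proof. by exists p. Qed.

Lemma patchT (D : set 'rV[R]_3) p x :
  D x -> patch (fun=> 0) D (peval p) x = peval p x.
Proof. by move=> Dx; rewrite patchE mem_set. Qed.

Lemma fset_solid f : fset f `<=` solid T.
Proof.
move=> x fx; suff: (solid T `\` (solid T)°) x by case.
by rewrite (solid_boundary hT); exists f.
Qed.

Lemma eset_tail e : eset e (vpos (etail e)).
Proof. by exists 0; rewrite /= ?scale0r ?addr0 // in_itv /= lexx ler01. Qed.

Lemma eset_head e : eset e (vpos (ehead e)).
Proof.
exists 1; rewrite /= ?in_itv /= ?lexx ?ler01 // scale1r /evec addrC subrK //.
Qed.

Lemma eset_end e m : m \in ends e -> eset e (vpos m).
Proof.
by rewrite !inE => /orP[] /eqP ->; [exact: eset_tail|exact: eset_head].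
Qed.

Lemma bedges_sub f e : e \in bedges f -> eset e `<=` fset f.
Proof. by rewrite inE => /asboolP. Qed.

(** An interior point is surrounded by segments in all coordinate directions; the other points of
    the solid are limits of interior ones. *)
Lemma grad_solid_eq0 p : (forall x, solid T x -> peval p x = 0) ->
  forall i x, solid T x -> peval (mderiv i p) x = 0.
Proof.
move=> p0 i x; rewrite -(solid_regular hT).
apply: (vanish_closure (f := peval (mderiv i p))).
  exact: continuous_peval.
move=> {}x /= xT.
have [r r0 rT] := near_line (delta_mx 0 i) xT.
have lt : - r < r by lra.
have := deriv_line_eq0 lt (fun s sr => p0 _ (rT s sr)) 0.
rewrite scale0r addr0 => <-.
rewrite /dot (bigD1 i) //= big1 => [|j ji]; rewrite !mxE eqxx.
  by rewrite eqxx mulr1 addr0.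
by rewrite (negbTE ji) mulr0.
Qed.

Lemma grad_face_eq0 p f : (forall x, fset f x -> peval p x = 0) ->
  forall d x, dot d (fnor f) = 0 -> fset f x -> dot (veval (grad p) x) d = 0.
Proof.
move=> p0 d x dn fx.
suff [t1 t2] : dot (veval (grad p) x) (ft1 f) = 0 /\
               dot (veval (grad p) x) (ft2 f) = 0.
  rewrite (frame_dec (frame_unit hT f) (frame_orth hT f) d) dn scale0r addr0.
  by rewrite dotDr !dotZr t1 t2 !mulr0 addr0.
have [y fy <-] : (@chart R T f @` freg f) x by [].
(* The argument runs in chart coordinates, where [freg f] is the closure of its interior; [h] is the
   planar direction that the chart maps to [d']. *)
have dir d' (h : R * R) :
    (forall y s, chart f (y + s *: h) = chart f y + s *: d') ->
    dot (veval (grad p) (chart f y)) d' = 0.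
  move=> hd.
  pose g z := dot (veval (grad p) (chart f z)) d'.
  have clg : closed (g @^-1` [set 0]).
    apply: closed_comp => [z _|]; last exact: closed_eq.
    apply: (continuous_comp (f := @chart R T f)
      (g := fun z => dot (veval (grad p) z) d')); first exact: continuous_chart.
    exact: continuous_dot_veval.
  have : closure (freg f)° y by rewrite (freg_regular hT).
  suff sub : (freg f)° `<=` g @^-1` [set 0].
    by move=> /(closureS sub); move/closure_id: clg => <-.
  move=> z /= zf.
  have [r r0 rT] := near_line h zf.
  have lt : - r < r by lra.
  rewrite /g -[chart f z]addr0 -[X in _ + X](scale0r d').
  apply: (deriv_line_eq0 lt) => s sr; apply: p0.
  exists (z + s *: h); last exact: hd.
  exact: (rT s sr).
split; [apply: (dir _ (1, 0))|apply: (dir _ (0, 1))] => z s; rewrite /chart /=.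
  have -> : s *: (1 : R) = s by exact: mulr1.
  by rewrite scaler0 addr0 scalerDl (addrA (forig f)) (addrAC _ (s *: _)).
have -> : s *: (1 : R) = s by exact: mulr1.
by rewrite scaler0 addr0 scalerDl (addrA (_ + _)).
Qed.

Lemma grad_edge_eq0 p e : (forall x, eset e x -> peval p x = 0) ->
  forall x, eset e x -> dot (veval (grad p) x) (etan e) = 0.
Proof.
move=> p0 x; rewrite esetE // => -[s sI <-].
apply: (deriv_line_eq0 (elen_gt0 hT e)) => u /andP[u0 u1]; apply: p0.
by rewrite esetE //; exists u => //=; rewrite in_itv /= !ltW.
Qed.

Local Notation IT := (fun p => intT T (peval p)).
Local Notation IF f := (fun p => intF f (peval p)).
Local Notation IE e := (fun p => intE e (peval p)).

Lemma wgrad_0_spec a j0 j1 j2 (v : cochain1 T) : space1 j0 j1 j2 v ->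
  let u := wgrad_0 n a v in XT T a u /\
    forall phi, vdegle a phi ->
      intT T (fun x => dot (u x) (veval phi x)) =
      - intT T (fun x => v_0 v x * peval (div phi) x) +
      \sum_f intF f (fun x => v_f v f x * dot (veval phi x) (n f)).
Proof.
move=> [/Pspace_poly [p0 [_ p0E _]] vf _] u; rewrite /u /wgrad_0.
have /choice [pf pfE] : forall f, exists p,
    forall x, fset f x -> v_f v f x = peval p x.
  by move=> f; have [p [_ pE _]] := Pspace_poly (vf f); exists p.
have iT := integral_on_solid hT; have iF := integral_on_face hT.
(* The right-hand side of the equation, with [v_0] and [v_f] replaced by polynomials agreeing with
   them on the solid and on the faces. *)
pose L (P : 'rV[poly3]_3) :=
  - IT (p0 * div P) + \sum_f IF f (pf f * cdot P (n f)).
have [||q qa qL] := riesz iT a (L := L).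
- move=> c P Q; rewrite /L div_linear mulrDr -scalerAr (integral_on_linear iT).
  have -> : \sum_f IF f (pf f * cdot (mpolyC 3 c *: P + Q) (n f)) =
      c * (\sum_f IF f (pf f * cdot P (n f))) +
      \sum_f IF f (pf f * cdot Q (n f)).
    rewrite mulr_sumr -big_split; apply: eq_bigr => f _.
    by rewrite cdot_linear mulrDr -scalerAr (integral_on_linear (iF f)).
  exact: opp_add_linear.
- move=> P P0; rewrite /L.
  rewrite (integral_on_ext iT (q := 0)) => [|x Tx]; last first.
    rewrite pevalM peval0 /div peval_sum big1 ?mulr0 // => i _.
    exact: grad_solid_eq0 (P0 i) i x Tx.
  rewrite (integral_on0 iT) oppr0 add0r big1 // => f _.
  rewrite (integral_on_ext (iF f) (q := 0)) ?(integral_on0 (iF f)) // => x fx.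
  rewrite pevalM peval0 /cdot peval_sum big1 ?mulr0 // => i _.
  by rewrite pevalZ P0 ?mulr0 //; exact: fset_solid fx.
(* The Riesz field, extended by zero off the solid, solves the equations, so [xget] does not return
   its default. *)
case: xgetP => [w _ //|noPw]; exfalso.
apply: (noPw (fun x => \row_i patch (fun=> 0) (solid T) (peval (q 0 i)) x)).
split.
  by move=> i /=; rewrite (funext (fun x => mxE _ _ _ _)); exact: Pspace_patch.
move=> phi phia; transitivity (L phi).
  rewrite -qL //; apply: intT_ext => x Tx.
  rewrite /pdot peval_sum; apply: eq_bigr => i _.
  by rewrite !mxE patchT // pevalM.
rewrite /L; congr (- _ + _).
  by apply: intT_ext => x Tx; rewrite pevalM p0E.
apply: eq_bigr => f _; apply: intF_ext => x fx.
by rewrite pevalM peval_cdot pfE.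
Qed.


Lemma dot_curl_face_eq0 f P : (forall i x, fset f x -> peval (P 0 i) x = 0) ->
  forall x, fset f x -> dot (veval (curl P) x) (fnor f) = 0.
Proof.
move=> P0 x fx.
rewrite (dot_curl_frame (frame_unit hT f) (frame_orth hT f)).
have c0 c y : fset f y -> peval (cdot P c) y = 0.
  move=> fy; rewrite peval_cdot /dot big1 // => i _.
  by rewrite mxE P0 // mul0r.
by rewrite !(grad_face_eq0 (f := f)) ?addr0 //; [exact: c0|exact: dot_crossr
  |exact: c0|exact: dot_crossr].
Qed.

(** The definition tests with tangential fields, but the volume curl supplies test fields with a
    normal component on the face. Each of the three integrands ignores that component, so the
    equation extends to all fields. *)
Lemma wgrad_f_spec b j0 j1 j2 (v : cochain1 T) f :
  (forall e, e \in bedges f -> dot (t f e) (fnor f) = 0) ->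
  space1 j0 j1 j2 v ->
  let u := wgrad_f t b v f in XF b f u /\
    forall P, vdegle b P ->
      intF f (fun x => dot (u x) (cross (veval P x) (fnor f))) =
      - intF f (fun x => v_f v f x * dot (veval (curl P) x) (fnor f)) +
      \sum_(e in bedges f)
        intE e (fun x => v_e v e x * dot (veval P x) (t f e)).
Proof.
move=> tn [_ /(_ f)/Pspace_poly [pf [_ pfE _]] ve] u; rewrite /u /wgrad_f.
have /choice [pe peE] : forall e, exists p,
    forall x, eset e x -> v_e v e x = peval p x.
  by move=> e; have [p [_ pE _]] := Pspace_poly (ve e); exists p.
have iF := integral_on_face hT f; have iE := integral_on_edge hT.
have un := frame_unit hT f; have orth := frame_orth hT f.
have [u1 u2 unn] := un; have [f12 f1n f2n] := orth.
pose L (P : 'rV[poly3]_3) := - IF f (pf * cdot (curl P) (fnor f))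
  + \sum_(e in bedges f) IE e (pe e * cdot P (t f e)).
have Llin c P Q : L (mpolyC 3 c *: P + Q) = c * L P + L Q.
  rewrite /L curl_linear cdot_linear mulrDr -scalerAr (integral_on_linear iF).
  have -> : \sum_(e in bedges f)
        IE e (pe e * cdot (mpolyC 3 c *: P + Q) (t f e)) =
      c * (\sum_(e in bedges f) IE e (pe e * cdot P (t f e))) +
      \sum_(e in bedges f) IE e (pe e * cdot Q (t f e)).
    rewrite mulr_sumr -big_split; apply: eq_bigr => e _.
    by rewrite cdot_linear mulrDr -scalerAr (integral_on_linear (iE e)).
  exact: opp_add_linear.
have L0 P : (forall i x, fset f x -> peval (P 0 i) x = 0) -> L P = 0.
  move=> P0; rewrite /L (integral_on_ext iF (q := 0)) => [|x fx]; last first.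
    by rewrite pevalM peval0 peval_cdot dot_curl_face_eq0 ?mulr0.
  rewrite (integral_on0 iF) oppr0 add0r big1 // => e ef.
  rewrite (integral_on_ext (iE e) (q := 0)) ?(integral_on0 (iE e)) // => x ex.
  rewrite pevalM peval0 /cdot peval_sum big1 ?mulr0 // => i _.
  by rewrite pevalZ P0 ?mulr0 //; exact: bedges_sub ef _ ex.
have LE P : L P =
    - intF f (fun x => v_f v f x * dot (veval (curl P) x) (fnor f)) +
    \sum_(e in bedges f) intE e (fun x => v_e v e x * dot (veval P x) (t f e)).
  rewrite /L; congr (- _ + _).
    by apply: intF_ext => x fx; rewrite pevalM peval_cdot pfE.
  apply: eq_bigr => e _; apply: intE_ext => x ex.
  by rewrite pevalM peval_cdot peE.
(* The orientation of the frame of the face, a sign. *)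
pose s := dot (cross (ft2 f) (fnor f)) (ft1 f).
have s2 : cross (ft2 f) (fnor f) = s *: ft1 f.
  rewrite {1}(frame_dec un orth (cross _ _)) dot_crossl dot_crossr.
  by rewrite !scale0r !addr0.
have s1 : cross (ft1 f) (fnor f) = - s *: ft2 f.
  rewrite {1}(frame_dec un orth (cross _ _)) dot_crossl dot_crossr.
  rewrite !scale0r addr0 add0r /s; congr (_ *: _).
  by rewrite dot_cross dotC [cross (fnor f) _]crossC dotNl.
have ss : s * s = 1.
  have : dot (cross (ft2 f) (fnor f)) (cross (ft2 f) (fnor f)) = 1.
    by rewrite dot_cross_cross u2 unn f2n mulr1 mul0r subr0.
  by rewrite s2 dotZl dotZr u1 mulr1.
(* theta x n_f is theta turned by a right angle in the plane of f; undoing that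
   rotation on the test fields turns the pairing into a plain dot product. *)
pose G (P : 'rV[poly3]_2) :=
  tangential (ft1 f) (ft2 f) (- s *: P 0 1) (s *: P 0 0).
have Glin c (P Q : 'rV[poly3]_2) :
    G (mpolyC 3 c *: P + Q) = mpolyC 3 c *: G P + G Q.
  rewrite -tangential_linear /G !mxE !mul_mpolyC !scalerDr !scalerA.
  by rewrite ![c * _]mulrC.
have [||q qb qL] := riesz iF b (L := L \o G).
- by move=> c P Q; rewrite /= Glin Llin.
- move=> P P0 /=; apply: L0 => i x fx.
  by rewrite mxE pevalD !pevalZ !P0 // !mulr0 addr0.
have testE p p' : L (tangential (ft1 f) (ft2 f) p p') =
    L (G (\row_i if i == 0 then s *: p' else - s *: p)).
  by rewrite /G !mxE /= !scalerA mulrNN ss !scale1r.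
case: xgetP => [w _ [wXF weq]|noPw]; last first.
  exfalso; apply: (noPw (fun x =>
    patch (fun=> 0) (fset f) (peval (q 0 0)) x *: ft1 f +
    patch (fun=> 0) (fset f) (peval (q 0 1)) x *: ft2 f)).
  split.
    exists (patch (fun=> 0) (fset f) (peval (q 0 0))),
      (patch (fun=> 0) (fset f) (peval (q 0 1))).
    by split => //; exact: Pspace_patch.
  move=> p p' pb pb' /=.
  rewrite -LE -/(tangential _ _ _ _) testE -[RHS]qL => [|i]; last first.
    by rewrite mxE; case: ifP => _; exact: degleZ.
  apply: intF_ext => x fx; rewrite !patchT // veval_tangential.
  rewrite crossDl !crossZl s1 s2.
  rewrite dotDl !dotDr !dotZl !dotZr u1 u2 [dot (ft2 f) _]dotC f12.
  rewrite /pdot peval_sum !big_ord_recl big_ord0 !mxE /= !pevalM !pevalZ.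
  rewrite (_ : lift _ _ = 1); last exact: val_inj.
  by ring.
split=> // P Pb.
(* The tangential part of [P]. Having the same tangential components as [P], it has the same normal
   curl component by [dot_curl_frame]. *)
pose th := tangential (ft1 f) (ft2 f) (cdot P (ft1 f)) (cdot P (ft2 f)).
have thE x : veval th x =
    dot (veval P x) (ft1 f) *: ft1 f + dot (veval P x) (ft2 f) *: ft2 f.
  by rewrite veval_tangential !peval_cdot.
have PE x : veval P x = veval th x + dot (veval P x) (fnor f) *: fnor f.
  by rewrite thE {1}(frame_dec un orth (veval P x)).
have E : intF f (fun x => dot (w x) (cross (veval th x) (fnor f))) =
    - intF f (fun x => v_f v f x * dot (veval (curl th) x) (fnor f)) +
    \sum_(e in bedges f) intE e (fun x => v_e v e x * dot (veval th x) (t f e)).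
  exact: weq _ _ (degle_cdot (ft1 f) Pb) (degle_cdot (ft2 f) Pb).
have cd1 : cdot th (ft1 f) = cdot P (ft1 f).
  by rewrite cdot_tangential u1 [dot (ft2 f) _]dotC f12 scale1r scale0r addr0.
have cd2 : cdot th (ft2 f) = cdot P (ft2 f).
  by rewrite cdot_tangential u2 f12 scale1r scale0r add0r.
clearbody th.
transitivity (intF f (fun x => dot (w x) (cross (veval th x) (fnor f)))).
  by apply: intF_ext => x _; rewrite PE crossDl crossZl crossvv scaler0 addr0.
rewrite E {E}; apply: (congr2 (fun y z : R => - y + z)).
  apply: intF_ext => x _.
  by rewrite !(dot_curl_frame un orth) cd1 cd2.
apply: eq_bigr => e ef; apply: intE_ext => x _; congr (_ * _).
by rewrite [in RHS]PE dotDl dotZl [dot (fnor f) _]dotC tn // mulr0 addr0.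
Qed.

Lemma wgrad_e_spec c0 j0 j1 j2 (v : cochain1 T) e : space1 j0 j1 j2 v ->
  let u := wgrad_e c0 v e in XE c0 e u /\
    forall phi, degle c0 phi ->
      intE e (fun x => dot (u x) (peval phi x *: etan e)) =
      - intE e (fun x => v_e v e x * dot (veval (grad phi) x) (etan e)) +
      \sum_(m in ends e)
        v_n v m * (peval phi (vpos m) * dot (etan e) (eout e m)).
Proof.
move=> [_ _ /(_ e)/Pspace_poly [pe [_ peE _]]] u; rewrite /u /wgrad_e.
have iE := integral_on_edge hT e.
pose L (P : 'rV[poly3]_1) := - IE e (pe * cdot (grad (P 0 0)) (etan e)) +
  \sum_(m in ends e)
    v_n v m * (peval (P 0 0) (vpos m) * dot (etan e) (eout e m)).
have [||q qc qL] := riesz iE c0 (L := L).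
- move=> a P Q; rewrite /L !mxE mul_mpolyC grad_linear cdot_linear mulrDr.
  rewrite -scalerAr (integral_on_linear iE).
  have -> : \sum_(m in ends e) v_n v m *
        (peval (a *: P 0 0 + Q 0 0) (vpos m) * dot (etan e) (eout e m)) =
      a * (\sum_(m in ends e) v_n v m *
        (peval (P 0 0) (vpos m) * dot (etan e) (eout e m))) +
      \sum_(m in ends e) v_n v m *
        (peval (Q 0 0) (vpos m) * dot (etan e) (eout e m)).
    rewrite mulr_sumr -big_split; apply: eq_bigr => m _ /=.
    by rewrite pevalD pevalZ; ring.
  exact: opp_add_linear.
- move=> P P0; rewrite /L (integral_on_ext iE (q := 0)) => [|x ex]; last first.
    rewrite pevalM peval0 peval_cdot (grad_edge_eq0 (e := e)) ?mulr0 //.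
    exact: P0.
  rewrite (integral_on0 iE) oppr0 add0r big1 // => m me.
  by rewrite P0 ?mul0r ?mulr0 //; exact: eset_end.
case: xgetP => [w _ //|noPw]; exfalso.
apply: (noPw (fun x => patch (fun=> 0) (eset e) (peval (q 0 0)) x *: etan e)).
split.
  exists (patch (fun=> 0) (eset e) (peval (q 0 0))) => //.
  exact: Pspace_patch.
move=> phi phic; have := qL (const_mx phi).
rewrite /L !mxE => qphi; transitivity (IE e (pdot q (const_mx phi))).
  apply: intE_ext => x ex; rewrite patchT // dotZl dotZr (etan_unit hT) mulr1.
  by rewrite /pdot big_ord1 mxE pevalM.
rewrite qphi => [|i]; last by rewrite mxE.
congr (- _ + _); apply: intE_ext => x ex.
by rewrite pevalM peE // peval_cdot.
Qed.

End WeakGradient.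

(** * Orientation at edges and vertices *)

Section TwoRays.
Variable R : realType.
Local Notation V := 'rV[R]_3.

Lemma near_right0_itv (P : R -> Prop) : (\forall s \near 0^'+, P s) ->
  exists2 r, 0 < r & forall s, 0 < s < r -> P s.
Proof.
move=> [r /= r0 rP]; exists r => // s /andP[s0 sr]; apply: rP => //=.
by rewrite sub0r normrN gtr0_norm.
Qed.

Lemma convex_gt0 (s p q : R) : 0 <= s <= 1 -> 0 < p -> 0 < q ->
  0 < (1 - s) * p + s * q.
Proof.
move=> /andP[s0 s1] p0 q0; have [->|sn0] := eqVneq s 0; first by lra.
have sp : 0 < s by rewrite lt_neqAle eq_sym sn0.
by apply: ltr_wpDl; [apply: mulr_ge0; lra|exact: mulr_gt0].
Qed.

Variables (A B : set V) (x w a a' : V).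
Hypotheses (ww : dot w w = 1) (aa : dot a a = 1) (aa' : dot a' a' = 1).
Hypotheses (aw : dot a w = 0) (aw' : dot a' w = 0).

(* The rays x + R+ a and x + R+ a' bound two sectors of the plane orthogonal to
   w, and w x a, w x a' point into opposite ones.  If A lay on these two sides,
   a short segment crossing the sector of angle at most pi would join a point
   of A next to one ray to a point outside A next to the other without meeting
   the boundary B. *)
Lemma two_rays :
  (forall P Q, dot (P - x) w = 0 -> dot (Q - x) w = 0 -> A P -> ~ A Q ->
     exists2 s : R, 0 <= s <= 1 & B (P + s *: (Q - P))) ->
  (\forall s \near 0^'+, \forall d \near 0^'+,
     A (x + s *: a + d *: cross w a) /\ ~ A (x + s *: a - d *: cross w a)) ->
  (\forall s \near 0^'+, \forall d \near 0^'+,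
     A (x + s *: a' + d *: cross w a') /\ ~ A (x + s *: a' - d *: cross w a')) ->
  (\forall y \near x, dot (y - x) w = 0 -> B y -> exists2 b, 0 <= b &
     y = x + b *: a \/ y = x + b *: a') ->
  a = a'.
Proof.
move=> seg ina ina' nearB; apply: contrapT => ana'.
pose N := cross w a.
have aN : dot a N = 0 by rewrite dotC dot_crossr.
have NN : dot N N = 1.
  by rewrite dot_cross_cross ww aa [dot w a]dotC aw mulr1 mul0r subr0.
have wN : cross w N = - a.
  by rewrite crossrA [dot w a]dotC aw ww scale0r sub0r scale1r.
have waN : cross a N = w.
  by rewrite crossrA aa aw scale0r scale1r subr0.
(* Cosine and sine of the angle from [a] to [a'] in the plane with orthonormal basis [a], [N]. *)
pose c := dot a' a; pose s := dot a' N.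
have a'E : a' = c *: a + s *: N.
  by rewrite {1}(frame_cross a' aa NN aN) waN aw' scale0r addr0.
have N'E : cross w a' = c *: N - s *: a.
  by rewrite {1}a'E crossDr !crossZr wN scalerN.
have cs : c ^+ 2 + s ^+ 2 = 1.
  have := aa'; rewrite {1 2}a'E dotDl !dotDr !dotZl !dotZr aa NN aN dotC aN.
  by rewrite !mulr0 addr0 add0r !mulr1 -!expr2.
pose pt u v := x + u *: a + v *: N.
have ptw u v : dot (pt u v - x) w = 0.
  rewrite (_ : pt u v - x = u *: a + v *: N); last first.
    by apply/rowP => i; rewrite !mxE; ring.
  rewrite dotDl !dotZl aw mulr0 add0r.
  by rewrite dot_crossl mulr0.
have ptE u v u' v' : pt u v = pt u' v' -> u = u' /\ v = v'.
  rewrite /pt -!addrA => /addrI E; split.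
    have := congr1 (fun z => dot z a) E.
    by rewrite !dotDl !dotZl aa [dot N a]dotC aN !mulr0 !addr0 !mulr1.
  have := congr1 (fun z => dot z N) E.
  by rewrite !dotDl !dotZl NN aN !mulr0 !add0r !mulr1.
have [r r0 rB] : exists2 r, 0 < r & forall u v, `|u| < r -> `|v| < r ->
    B (pt u v) -> exists2 b, 0 <= b &
      (u = b /\ v = 0) \/ (u = b * c /\ v = b * s).
  have ptc : continuous (fun p : R * R => pt p.1 p.2).
    move=> p; apply: cvgD; first apply: cvgD; first exact: cvg_cst.
      by apply: cvgZr_tmp; exact: cvg_fst.
    by apply: cvgZr_tmp; exact: cvg_snd.
  have pt0 : pt 0 0 = x by rewrite /pt !scale0r !addr0.
  have ptx : (fun p : R * R => pt p.1 p.2) p @[p --> (0, 0)] --> x.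
    by rewrite -[X in _ --> X]pt0; exact: (ptc (0, 0)).
  have /nbhs_ballP [r /= r0 rP] := ptx _ nearB.
  exists r => // u v ur vr Buv.
  have [|b b0 E] := rP (u, v) _ (ptw u v) Buv.
    by split; rewrite /ball /= sub0r normrN.
  exists b => //; case: E => E.
    by left; apply: ptE; rewrite E /pt scale0r addr0.
  right; apply: ptE; rewrite E a'E /pt scalerDr !scalerA addrA //.
have segE t u1 v1 u2 v2 : (pt u1 v1 + t *: (pt u2 v2 - pt u1 v1)) =
    pt ((1 - t) * u1 + t * u2) ((1 - t) * v1 + t * v2).
  by apply/rowP => i; rewrite !mxE; ring.
have posA u d : x + u *: a + d *: N = pt u d by [].
have negA u d : x + u *: a - d *: N = pt u (- d) by rewrite /pt scaleNr.
have posA' u d :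
    x + u *: a' + d *: cross w a' = pt (u * c - d * s) (u * s + d * c).
  by rewrite N'E a'E; apply/rowP => i; rewrite !mxE; ring.
have negA' u d :
    x + u *: a' - d *: cross w a' = pt (u * c + d * s) (u * s - d * c).
  by rewrite N'E a'E; apply/rowP => i; rewrite !mxE; ring.
have [u [u0 ur uA uA']] : exists u, [/\ 0 < u, u < r / 4,
    \forall d \near 0^'+, A (pt u d) /\ ~ A (pt u (- d)) &
    \forall d \near 0^'+, A (pt (u * c - d * s) (u * s + d * c)) /\
       ~ A (pt (u * c + d * s) (u * s - d * c))].
  near ((0 : R)^'+) => u; exists u; split; near: u.
  - exact: nbhs_right_gt.
  - by apply: nbhs_right_lt; lra.
  - by apply: filterS ina => u; apply: filterS => d; rewrite posA negA.
  - by apply: filterS ina' => u; apply: filterS => d; rewrite posA' negA'.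
(* The bound by u|s| keeps a point displaced by [d] from one ray on the same side of the line
   through the other ray. The bounds by r/4 keep the whole segment in the range of [rB]. *)
have [d [d0 dr du [A1 nA1] [A2 nA2]]] : exists d, [/\ 0 < d, d < r / 4,
    s != 0 -> d < u * `|s|, A (pt u d) /\ ~ A (pt u (- d)) &
    A (pt (u * c - d * s) (u * s + d * c)) /\
       ~ A (pt (u * c + d * s) (u * s - d * c))].
  near ((0 : R)^'+) => d; exists d; split; near: d.
  - exact: nbhs_right_gt.
  - by apply: nbhs_right_lt; lra.
  - have [->|sn0] := eqVneq s 0; first by apply: nearW.
    have us : 0 < u * `|s| by rewrite mulr_gt0 ?normr_gt0.
    by apply: filterS (nbhs_right_lt us).
  - exact: uA.
  - exact: uA'.
have c1 : `|c| <= 1.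
  by rewrite -(expr_le1 (n := 2)) // real_normK ?num_real //; nra.
have cle1 : c <= 1 := le_trans (ler_norm c) c1.
have s1 : `|s| <= 1.
  by rewrite -(expr_le1 (n := 2)) // real_normK ?num_real //; nra.
have norm1 y z : `|y| <= 1 -> 0 < z -> z < r / 4 -> `|z * y| < r / 4.
  move=> y1 z0 zr; rewrite normrM (gtr0_norm z0); apply: le_lt_trans zr.
  by rewrite ler_piMr // ltW.
have bound t y1 y2 z1 z2 : 0 <= t <= 1 -> `|y1| < r / 4 -> `|y2| < r / 4 ->
    `|z1| < r / 4 -> `|z2| < r / 4 ->
    `|(1 - t) * (y1 + y2) + t * (z1 + z2)| < r.
  move=> /andP[t0 t1]; rewrite !ltr_norml.
  move=> /andP[? ?] /andP[? ?] /andP[? ?] /andP[? ?].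
  by apply/andP; split; nra.
have n0 : `|0 : R| < r / 4 by rewrite normr0; lra.
have nu : `|u| < r / 4 by rewrite gtr0_norm.
have nd : `|d| < r / 4 by rewrite gtr0_norm.
have nNd : `|- d| < r / 4 by rewrite normrN.
have [s0|s0|s0] := ltrgt0P s.
(* The segment joins the two displaced points inside the sector from [a] counterclockwise to [a'].
   The second coordinate is positive along it, which excludes the ray of [a]; the form (u, v) -> u s
   - v c is positive too, which excludes that of [a']. *)
- have dlt : d * c < u * s.
    have := du; rewrite (gtr0_norm s0) => /(_ (lt0r_neq0 s0)).
    by apply: le_lt_trans; rewrite ler_piMr // ltW.
  have [||t tI] := seg _ _ _ _ A1 nA2; try exact: ptw.
  rewrite segE => /rB[||b b0 [[_]|[uE vE]]].
  + have := bound t u 0 (u * c) (d * s) tI nu n0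
      (norm1 _ _ c1 u0 ur) (norm1 _ _ s1 d0 dr).
    by rewrite addr0.
  + have := bound t d 0 (u * s) (- (d * c)) tI nd n0 (norm1 _ _ s1 u0 ur).
    by rewrite addr0 normrN; apply; exact: norm1.
  + apply/eqP; rewrite gt_eqF // convex_gt0 //; lra.
  + have p2 : 0 < u * s - d * c by lra.
    have := convex_gt0 tI p2 d0.
    have -> : (1 - t) * (u * s - d * c) + t * d = b * c * s - b * s * c.
      rewrite -uE -vE.
      transitivity ((1 - t) * (u * s - d * c) + t * (d * (c ^+ 2 + s ^+ 2))).
        by rewrite cs mulr1.
      by ring.
    by rewrite mulrAC subrr ltxx.
(* The sector now lies clockwise from [a], so the roles of the two rays are exchanged. *)
- have dlt : d * c < - (u * s).
    have := du; rewrite (ltr0_norm s0) mulrN => /(_ (ltr0_neq0 s0)).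
    by apply: le_lt_trans; rewrite ler_piMr // ltW.
  have [||t tI] := seg _ _ _ _ A2 nA1; try exact: ptw.
  rewrite segE => /rB[||b b0 [[_ vE]|[uE vE]]].
  + have := bound t (u * c) (- (d * s)) u 0 tI (norm1 _ _ c1 u0 ur).
    by rewrite addr0 normrN; apply => //; exact: norm1.
  + have := bound t (u * s) (d * c) (- d) 0 tI (norm1 _ _ s1 u0 ur).
    by rewrite addr0; apply => //; exact: norm1.
  + have p1 : 0 < - (u * s + d * c) by lra.
    by have := convex_gt0 tI p1 d0; lra.
  + have p2 : 0 < - (u * s + d * c) by lra.
    have := convex_gt0 tI d0 p2.
    have -> : (1 - t) * d + t * - (u * s + d * c) = b * s * c - b * c * s.
      rewrite -uE -vE.
      transitivity ((1 - t) * (d * (c ^+ 2 + s ^+ 2)) + t * - (u * s + d * c)).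
        by rewrite cs mulr1.
      by ring.
    by rewrite mulrAC subrr ltxx.
(* The rays are opposite, since c = 1 would give [a = a']; the segment runs parallel to them at
   height [d]. *)
- have cN : c = -1.
    have : (c - 1) * (c + 1) = c ^+ 2 + s ^+ 2 - 1 by rewrite s0; ring.
    rewrite cs subrr => /eqP; rewrite mulf_eq0 subr_eq0 addr_eq0.
    move=> /orP[/eqP c1'|/eqP //].
    by exfalso; apply: ana'; rewrite a'E c1' s0 scale1r scale0r addr0.
  have [||t tI] := seg _ _ _ _ A1 nA2; try exact: ptw.
  rewrite segE => /rB[||b b0 E].
  + have := bound t u 0 (u * c) (d * s) tI nu n0
      (norm1 _ _ c1 u0 ur) (norm1 _ _ s1 d0 dr).
    by rewrite addr0.
  + have := bound t d 0 (u * s) (- (d * c)) tI nd n0 (norm1 _ _ s1 u0 ur).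
    by rewrite addr0 normrN; apply; exact: norm1.
  + have := convex_gt0 tI d0 d0; case: E => -[_]; rewrite ?s0 cN; lra.
Unshelve. all: by end_near. Qed.
End TwoRays.

(** If the path avoided [S] minus its interior, the preimage of [S] would be open and closed in the
    connected interval [0, 1]. *)
Lemma path_boundary (R : realType) (Y : topologicalType) (S : set Y)
    (g : R -> Y) :
  closed S -> continuous g -> S (g 0) -> ~ S (g 1) ->
  exists2 s : R, 0 <= s <= 1 & (S `\` S°) (g s).
Proof.
move=> clS cg S0 S1; apply: contrapT => noB.
have int s : 0 <= s <= 1 -> S (g s) -> S° (g s).
  by move=> sI Sg; apply: contrapT => nS; apply: noB; exists s.
have conn : connected (`[0, 1]%classic : set R).
  by apply/connected_intervalP; exact: interval_is_interval.
have : `[0, 1]%classic `&` g @^-1` S = `[0, 1]%classic.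
  apply: conn.
  - by exists 0; split => //=; rewrite in_itv /= lexx ler01.
  - exists (g @^-1` S°).
      by apply: open_comp => [s _|]; [exact: cg|exact: open_interior].
    apply/seteqP; split => s [sI /= Sg]; split => //; last first.
      exact: interior_subset Sg.
    by apply: int => //; move: sI; rewrite /= in_itv.
  - exists (g @^-1` S) => //.
    by apply: closed_comp => // s _; exact: cg.
move=> /seteqP[_ /(_ 1)] /= []; first by rewrite in_itv /= lexx ler01.
by [].
Qed.

(** Localizes at [x]: close to [x], only the faces or edges through [x] can be met. *)
Lemma near_closed_family (I : finType) (Y : topologicalType)
    (S : I -> set Y) x : (forall i, closed (S i)) ->
  \forall y \near x, forall i, S i y -> S i x.
Proof.
move=> clS; apply: filter_forall => i.
have [Sx|nSx] := pselect (S i x); first exact: nearW.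
have : nbhs x (~` S i).
  by apply: open_nbhs_nbhs; split => //; exact: closed_openC.
by apply: filterS => y nSy /nSy.
Qed.

(** * Incidence of faces, edges and vertices *)

Section Geometry.
Variables (R : realType) (T : solid_complex R).
Hypothesis hT : is_polyhedron T.
Implicit Types (f : face T) (e : edge T) (m : vertex T) (x y : 'rV[R]_3).

Lemma eset_closed e : closed (eset e).
Proof.
by apply: compact_closed (eset_compact (e := e)); exact: norm_hausdorff.
Qed.

Lemma fset_closed f : closed (fset f).
Proof.
by apply: compact_closed (fset_compact hT (f := f)); exact: norm_hausdorff.
Qed.

Lemma eset_dir e x : eset e x -> exists s, x = vpos (etail e) + s *: etan e.
Proof. by rewrite esetE // => -[s _ <-]; exists s. Qed.

Lemma plane_orth f x y : fset f x -> fset f y -> dot (x - y) (fnor f) = 0.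
Proof.
have [_ o1 o2] := frame_orth hT f.
move=> [p _ <-] [q _ <-].
rewrite (_ : _ - _ = (p.1 - q.1) *: ft1 f + (p.2 - q.2) *: ft2 f); last first.
  by apply/rowP => i; rewrite !mxE; ring.
by rewrite dotDl !dotZl o1 o2 !mulr0 addr0.
Qed.

Lemma edge_orth f e : e \in bedges f -> dot (etan e) (fnor f) = 0.
Proof.
move=> /bedges_sub ef.
have := plane_orth (ef _ (eset_head e)) (ef _ (eset_tail e)).
rewrite -/(evec e) evecE // dotZl => /eqP; rewrite mulf_eq0 gt_eqF ?elen_gt0 //.
by move=> /eqP.
Qed.

Lemma chart_inj f : injective (@chart R T f).
Proof.
have [u1 u2 _] := frame_unit hT f; have [u12 _ _] := frame_orth hT f.
move=> [p1 p2] [q1 q2]; rewrite /chart /= -!addrA => /addrI E.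
have := congr1 (fun z => dot z (ft1 f)) E.
have := congr1 (fun z => dot z (ft2 f)) E.
rewrite /= !dotDl !dotZl u1 u2 [dot (ft2 f) _]dotC u12.
by rewrite !mulr0 !add0r !addr0 !mulr1 => -> ->.
Qed.

Lemma plane_chart f x y : fset f x -> dot (y - x) (fnor f) = 0 ->
  exists p, y = chart f p.
Proof.
move=> [p _ <-]; set x0 := chart f p => yx.
exists (p.1 + dot (y - x0) (ft1 f), p.2 + dot (y - x0) (ft2 f)).
have := frame_dec (frame_unit hT f) (frame_orth hT f) (y - x0).
rewrite yx scale0r addr0 => E.
rewrite -[LHS](subrK x0) {1}E /x0 /chart /= !scalerDl.
by apply/rowP => i; rewrite !mxE; ring.
Qed.

Lemma end_notin_erelint e m : m \in ends e -> ~ erelint e (vpos m).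
Proof.
have vn0 : evec e != 0.
  apply/eqP => E; have := etan_unit hT e.
  by rewrite /etan E scaler0 dot0l => /eqP; rewrite eq_sym oner_eq0.
rewrite !inE => /orP[] /eqP -> [s /=]; rewrite in_itv /= => /andP[s0 s1].
  move=> /eqP; rewrite -subr_eq0 addrAC subrr add0r scaler_eq0.
  by rewrite (negbTE vn0) orbF gt_eqF.
move=> /eqP; rewrite -[vpos (ehead e)](subrK (vpos (etail e))) -/(evec e).
rewrite addrC -subr_eq0 opprD addrACA subrr addr0 -{2}[evec e]scale1r -scalerBl.
by rewrite scaler_eq0 (negbTE vn0) orbF subr_eq0 lt_eqF.
Qed.

Lemma erelint_sub e : erelint e `<=` eset e.
Proof.
move=> _ [s sI <-]; exists s => //; move: sI; rewrite /= !in_itv /=.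
by move=> /andP[? ?]; rewrite !ltW.
Qed.

Lemma erelint_uniq e e' x : erelint e x -> eset e' x -> e' = e.
Proof.
move=> ex ex'; apply/eqP; apply: contraT; rewrite eq_sym => ee'.
have [m [me _ xm]] := edges_meet hT ee' (erelint_sub ex) ex'.
by case: (end_notin_erelint me); rewrite -xm.
Qed.

Lemma fsetE f x : fset f x -> frelint f x \/ frelbd f x.
Proof.
move=> [p pf <-]; have [pi|npi] := pselect ((freg f)° p).
  by left; exists p.
by right; exists p.
Qed.

(** Ensures that only the two faces sharing [e] pass through [x]. A different face cannot contain
    [x] in its relative interior, hence has [x] on one of its edges, and that edge must be [e]. *)
Lemma erelint_face e f f' x : e \in bedges f -> erelint e x -> fset f' x ->
  e \in bedges f'.
Proof.
move=> ef ex fx'; have fx := bedges_sub ef (erelint_sub ex).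
have [<- //|ff'] := eqVneq f f'.
have [ix|] := fsetE fx'.
  rewrite eq_sym in ff'; have /seteqP[/(_ x) H _] := faces_meet hT ff'.
  by case: H.
rewrite (face_boundary hT) => -[e' /= e'f' ex'].
by rewrite -(erelint_uniq ex ex').
Qed.

End Geometry.

(** * The two faces at an edge *)

Section Orientation.
Variables (R : realType) (T : solid_complex R).
Hypothesis hT : is_polyhedron T.
Implicit Types (f : face T) (e : edge T) (m : vertex T) (x y : 'rV[R]_3).

Lemma continuous_dot (x a : 'rV[R]_3) : continuous (fun y => dot (y - x) a).
Proof.
pose p : mpoly 3 R := \sum_i a 0 i *: mpolyX R (mnm1 i) - mpolyC 3 (dot x a).
rewrite (_ : (fun y => _) = peval p); first exact: continuous_peval.
apply/funext => y; rewrite /p pevalB peval_sum pevalC dotDl dotNl.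
by congr (_ - _); apply: eq_bigr => i _; rewrite pevalZ pevalX mulrC.
Qed.

Lemma near_line_right (x d : 'rV[R]_3) (U : set 'rV[R]_3) :
  (\forall y \near x, U y) -> \forall s \near 0^'+, U (x + s *: d).
Proof.
move=> xU; have [r r0 rU] := near_line d xU.
near=> s; apply: rU; apply/andP; split.
  by apply: (@lt_trans _ _ 0); [rewrite oppr_lt0|near: s; exact: nbhs_right_gt].
by near: s; exact: nbhs_right_lt.
Unshelve. all: by end_near. Qed.

Section FaceEdge.
Variables (f : face T) (e : edge T) (t : 'rV[R]_3).
Hypotheses (ef : e \in bedges f) (te : t = etan e \/ t = - etan e).
Let a := cross (fnor f) t.

Lemma tangent_unit : dot t t = 1.
Proof. by case: te => ->; rewrite ?dotNl ?dotNr ?opprK (etan_unit hT). Qed.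

Lemma tangent_fnor : dot t (fnor f) = 0.
Proof. by case: te => ->; rewrite ?dotNl (edge_orth hT ef) ?oppr0. Qed.

Lemma inward_unit : dot a a = 1.
Proof.
have [_ _ nn] := frame_unit hT f.
by rewrite dot_cross_cross nn tangent_unit tangent_fnor mulr1 mulr0 subr0.
Qed.

Lemma inward_etan : dot a (etan e) = 0.
Proof.
have := dot_crossr (fnor f) t; rewrite -/a.
by case: te => -> //; rewrite dotNr => /eqP; rewrite oppr_eq0 => /eqP.
Qed.

Lemma tangent_dot0 v : dot v (etan e) = 0 -> dot v t = 0.
Proof. by case: te => -> // ve; rewrite dotNr ve oppr0. Qed.

Hypothesis ht : forall x, erelint e x -> \forall s \near 0^'+,
  fset f (x + s *: a) /\ ~ fset f (x - s *: a).
Variable x : 'rV[R]_3.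
Hypothesis ex : erelint e x.

(** Outward normals are characterized at relative interior points only. A point x + s a on the
    boundary of the face would lie on [e], the only edge near [x], but [a] is orthogonal to [e]. *)
Lemma frelint_near : \forall s \near 0^'+, frelint f (x + s *: a).
Proof.
have cl := near_line_right a (near_closed_family x (@eset_closed R T)).
near=> s; have s0 : 0 < s by near: s; exact: nbhs_right_gt.
have [fs _] : fset f (x + s *: a) /\ ~ fset f (x - s *: a).
  by near: s; exact: ht.
have [//|] := fsetE fs; rewrite (face_boundary hT) => -[e' /= e'f e'x].
have e'e : e' = e.
  apply: (erelint_uniq hT ex).
  have : forall e0, eset e0 (x + s *: a) -> eset e0 x by near: s.
  exact.
rewrite e'e in e'x; have [u uE] := eset_dir hT e'x.
have [u' u'E] := eset_dir hT (erelint_sub ex).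
have : dot (x + s *: a - x) a = dot ((u - u') *: etan e) a.
  by congr dot; rewrite uE u'E; apply/rowP => i; rewrite !mxE; ring.
(* [dotZl] is given its scalar because [etan e] itself unfolds to a scaling. *)
rewrite addrAC subrr add0r (dotZl s) (dotZl (u - u')) inward_unit.
rewrite [dot (etan e) a]dotC inward_etan.
by rewrite mulr0 mulr1 => s00; rewrite s00 ltxx in s0.
Unshelve. all: by end_near. Qed.

Lemma face_ray : \forall y \near x, dot (y - x) (etan e) = 0 -> fset f y ->
  exists2 b, 0 <= b & y = x + b *: a.
Proof.
have fx : fset f x by apply: bedges_sub ef _ (erelint_sub ex).
have [r r0 rf] := near_right0_itv (ht ex).
have near_b : \forall y \near x, `|dot (y - x) a| < r.
  have c0 : dot (y - x) a @[y --> x] --> (0 : R).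
    by have := @continuous_dot x a x; rewrite /continuous_at subrr dot0l.
  exact: (cvgr0_norm_lt _ c0 r r0).
apply: filterS near_b => y yr ye fy.
have [_ _ nn] := frame_unit hT f.
have nt : dot (fnor f) t = 0 by rewrite dotC tangent_fnor.
have := frame_cross (y - x) nn tangent_unit nt.
rewrite (plane_orth hT fy fx) tangent_dot0 // !scale0r !add0r -/a => yE.
have yE' : y = x + dot (y - x) a *: a by rewrite -yE addrC subrK.
exists (dot (y - x) a) => //; rewrite leNgt; apply/negP => b0.
have [|_] := rf (- dot (y - x) a).
  by rewrite oppr_gt0 b0 /=; apply: le_lt_trans yr; rewrite -normrN ler_norm.
by apply; rewrite scaleNr opprK -yE'.
Qed.

End FaceEdge.

Lemma solid_segment (P Q : 'rV[R]_3) : solid T P -> ~ solid T Q ->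
  exists2 s : R, 0 <= s <= 1 & (solid T `\` (solid T)°) (P + s *: (Q - P)).
Proof.
move=> TP TQ; apply: (path_boundary (g := fun s => P + s *: (Q - P))).
- by apply: compact_closed (solid_compact hT); exact: norm_hausdorff.
- exact: continuous_line.
- by rewrite scale0r addr0.
- by rewrite scale1r addrC subrK.
Qed.

(** The segment is pulled back to chart coordinates, in which the relative boundary is a topological
    boundary. *)
Lemma face_segment f x (P Q : 'rV[R]_3) : fset f x ->
  dot (P - x) (fnor f) = 0 -> dot (Q - x) (fnor f) = 0 ->
  fset f P -> ~ fset f Q ->
  exists2 s : R, 0 <= s <= 1 & frelbd f (P + s *: (Q - P)).
Proof.
move=> fx Px Qx fP fQ.
have [p pE] := plane_chart hT fx Px; have [q qE] := plane_chart hT fx Qx.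
have gE s : chart f (p + s *: (q - p)) = P + s *: (Q - P).
  rewrite pE qE /chart; apply/rowP => i; rewrite !mxE /=.
  rewrite -[s *: (q.1 - p.1)]/(s * (q.1 - p.1)).
  rewrite -[s *: (q.2 - p.2)]/(s * (q.2 - p.2)).
  by ring.
have [||||s sI sB] :=
  @path_boundary R _ (freg f) (fun s : R => p + s *: (q - p)).
- by apply: compact_closed (freg_compact hT (f := f)); exact: norm_hausdorff.
- by move=> s; apply: cvgD; [exact: cvg_cst|apply: cvgZr_tmp; exact: cvg_id].
- rewrite scale0r addr0; case: fP => p' fp'; rewrite pE => /(chart_inj hT).
  by move=> <-.
- by rewrite scale1r addrC subrK => fq; apply: fQ; exists q.
- by exists s => //; exists (p + s *: (q - p)).
Qed.

Lemma edge_orientation f f' e (nf nf' t t' : 'rV[R]_3) (s s' : R) :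
  outward_normal f nf -> outward_normal f' nf' ->
  right_hand_tangent f e t -> right_hand_tangent f' e t' ->
  e \in bedges f -> e \in bedges f' -> f != f' ->
  (forall g, e \in bedges g -> g = f \/ g = f') ->
  nf = s *: fnor f -> nf' = s' *: fnor f' ->
  s ^+ 2 = 1 -> s' ^+ 2 = 1 ->
  s *: t + s' *: t' = 0.
Proof.
move=> [_ onf] [_ onf'] [te ht] [te' ht'] ef ef' ff' only nE nE' s2 s2'.
(* Both vectors are plus or minus [etan e]. The equal case is refuted in the plane through [x]
   orthogonal to the edge. *)
have [//|st] : s *: t + s' *: t' = 0 \/ s *: t = s' *: t'.
  have sgn z : z ^+ 2 = 1 -> z = 1 \/ z = -1 :> R.
    by move=> /eqP; rewrite sqrf_eq1 => /orP[] /eqP; [left|right].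
  case: (sgn _ s2) => ->; case: (sgn _ s2') => ->;
  case: te => ->; case: te' => ->;
  rewrite ?scaleN1r ?scale1r ?opprK ?subrr ?addNr; by [left|right].
exfalso.
pose x := vpos (etail e) + 2^-1 *: evec e.
have ex : erelint e x.
  by exists (2^-1) => //=; rewrite in_itv /=; apply/andP; split; lra.
pose a := cross (fnor f) t; pose a' := cross (fnor f') t'.
(* With this choice w x a and w x a' are the inward normals of the two faces, so the solid lies on
   those sides of the rays. *)
pose w := - (s *: t).
have wE : w = - (s' *: t') by rewrite /w st.
have tt := tangent_unit te; have tt' := tangent_unit te'.
have tn := tangent_fnor ef te; have tn' := tangent_fnor ef' te'.
have wa : cross w a = - nf.
  by rewrite crossNl crossZl crossrA tt tn scale0r subr0 scale1r nE.
have wa' : cross w a' = - nf'.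
  by rewrite wE crossNl crossZl crossrA tt' tn' scale0r subr0 scale1r nE'.
have aw : dot a w = 0 by rewrite dotNr dotZr dot_crossr mulr0 oppr0.
have aw' : dot a' w = 0 by rewrite wE dotNr dotZr dot_crossr mulr0 oppr0.
have ww : dot w w = 1.
  by rewrite dotNl dotNr opprK dotZl dotZr tt mulr1 -expr2.
have we y : dot y w = 0 -> dot y (etan e) = 0.
  rewrite dotNr dotZr => /eqP; rewrite oppr_eq0 mulf_eq0.
  have -> /= : s == 0 = false.
    apply/eqP => s0; move: s2; rewrite s0 expr0n /= => /eqP.
    by rewrite eq_sym oner_eq0.
  by case: te => -> /eqP //; rewrite dotNr => /eqP; rewrite oppr_eq0 => /eqP.
have int := frelint_near ef te ht ex; have int' := frelint_near ef' te' ht' ex.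
have aa' : a = a'.
  apply: (two_rays (A := solid T) (B := solid T `\` (solid T)°) (x := x) ww
    (inward_unit ef te) (inward_unit ef' te') aw aw').
  - by move=> P Q _ _; exact: solid_segment.
  - apply: filterS int => u /onf; apply: filterS => d.
    by rewrite wa scalerN opprK.
  - apply: filterS int' => u /onf'; apply: filterS => d.
    by rewrite wa' scalerN opprK.
  - have cl := near_closed_family x (@fset_closed R T hT).
    have ray := face_ray ef te ht ex; have ray' := face_ray ef' te' ht' ex.
    apply: filterS3 ray ray' cl => y yray yray' clos /we ye.
    rewrite (solid_boundary hT) => -[g _ gy].
    have [gf|gf'] := only g (erelint_face hT ef ex (clos _ gy)).
      rewrite gf in gy; have [b b0 bE] := yray ye gy.
      by exists b => //; left.
    rewrite gf' in gy; have [b b0 bE] := yray' ye gy.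
    by exists b => //; right.
(* Coinciding rays would give the two faces a common relative interior point. *)
have [u [iu iu']] :
    exists u, frelint f (x + u *: a) /\ frelint f' (x + u *: a').
  by near ((0 : R)^'+) => u; exists u; split; near: u.
have /seteqP[/(_ (x + u *: a)) H _] := faces_meet hT ff'.
apply: H; split => //; rewrite aa'; case: iu' => p /interior_subset pf' <-.
by exists p.
Unshelve. all: by end_near. Qed.

End Orientation.

(** * The two edges of a face at a vertex *)

Section Vertices.
Variables (R : realType) (T : solid_complex R).
Hypothesis hT : is_polyhedron T.
Implicit Types (f : face T) (e : edge T) (m : vertex T) (x y : 'rV[R]_3).

Lemma eout_etan e m : eout e m = etan e \/ eout e m = - etan e.
Proof. by rewrite /eout; case: ifP => _; [left|right]. Qed.

Lemma eset_from_end e m : m \in ends e ->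
  (forall s, 0 < s < elen e -> erelint e (vpos m + s *: - eout e m)) /\
  (forall y, eset e y -> exists2 b, 0 <= b & y = vpos m + b *: - eout e m).
Proof.
have e0 := elen_gt0 hT e; have en0 : elen e != 0 by rewrite gt_eqF.
have headE : vpos (ehead e) = vpos (etail e) + elen e *: etan e.
  by rewrite -evecE // /evec addrC subrK.
rewrite !inE /eout => /orP[] /eqP ->.
  rewrite (negbTE (ends_neq hT e)) opprK; split => [s /andP[s0 s1]|y].
    exists (s / elen e); last by rewrite evecE // scalerA divfK.
    by rewrite /= in_itv /= divr_gt0 // ltr_pdivrMr // mul1r.
  rewrite (esetE hT) => -[s /=]; rewrite in_itv /= => /andP[s0 _] <-.
  by exists s.
rewrite eqxx; split => [s /andP[s0 s1]|y].
  exists (1 - s / elen e).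
    rewrite /= in_itv /= subr_gt0 ltr_pdivrMr // mul1r s1 /=.
    by rewrite ltrBlDr ltrDl divr_gt0.
  rewrite headE evecE // scalerA mulrBl divfK // mul1r scalerBl scalerN.
  by rewrite addrA.
rewrite (esetE hT) => -[s /=]; rewrite in_itv /= => /andP[s0 s1] <-.
exists (elen e - s); first by rewrite subr_ge0.
by rewrite headE; apply/rowP => i; rewrite !mxE; ring.
Qed.

Lemma vertex_of_edge e m : eset e (vpos m) -> m \in ends e.
Proof.
move=> em; have [e' me'] := vertex_end hT m.
have [-> //|ee'] := eqVneq e e'.
have [m' [m'e m'e' mm']] := edges_meet hT ee' em (eset_end me').
by rewrite (vpos_inj hT mm').
Qed.

Lemma vertex_orientation f m e e' (t t' : 'rV[R]_3) :
  right_hand_tangent f e t -> right_hand_tangent f e' t' ->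
  e \in bedges f -> e' \in bedges f -> m \in ends e -> m \in ends e' ->
  e != e' ->
  (forall e0, e0 \in bedges f -> m \in ends e0 -> e0 = e \/ e0 = e') ->
  dot t (eout e m) + dot t' (eout e' m) = 0.
Proof.
move=> [te ht] [te' ht'] ef ef' me me' ee' only.
pose a := - eout e m; pose a' := - eout e' m.
have [_ _ nn] := frame_unit hT f.
have eout_unit e0 : dot (eout e0 m) (eout e0 m) = 1.
  by case: (eout_etan e0 m) => ->; rewrite ?dotNl ?dotNr ?opprK (etan_unit hT).
have aa : dot a a = 1 by rewrite dotNl dotNr opprK eout_unit.
have aa' : dot a' a' = 1 by rewrite dotNl dotNr opprK eout_unit.
have an : dot a (fnor f) = 0.
  by rewrite dotNl; case: (eout_etan e m) => ->;
    rewrite ?dotNl (edge_orth hT ef) ?oppr0.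
have an' : dot a' (fnor f) = 0.
  by rewrite dotNl; case: (eout_etan e' m) => ->;
    rewrite ?dotNl (edge_orth hT ef') ?oppr0.
have signs e0 t0 : t0 = etan e0 \/ t0 = - etan e0 ->
    exists2 s : R, s = 1 \/ s = -1 &
      t0 = s *: - eout e0 m /\ dot t0 (eout e0 m) = - s.
  move=> t0e; have [s s1 tE] : exists2 s : R, s = 1 \/ s = -1 &
      t0 = s *: - eout e0 m.
    case: t0e => ->; case: (eout_etan e0 m) => ->.
    - by exists (-1); [right|rewrite scaleN1r opprK].
    - by exists 1; [left|rewrite scale1r opprK].
    - by exists 1; [left|rewrite scale1r].
    - by exists (-1); [right|rewrite scaleN1r opprK].
  exists s => //; split => //.
  by rewrite tE dotZl dotNl eout_unit mulrN1.
have [s s1 [tE ->]] := signs _ _ te; have [s' s1' [tE' ->]] := signs _ _ te'.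
(* A sign records whether the tangent leaves the vertex or arrives there. Opposite signs give the
   claim; equal signs are excluded by [two_rays]. *)
have [->|ss'] : s' = - s \/ s' = s.
  by case: s1 => ->; case: s1' => ->; rewrite ?opprK; by [left|right].
  by rewrite opprK addNr.
exfalso; rewrite {}ss' in tE' {s1'}.
have ss : s * s = 1 by case: s1 => ->; rewrite ?mulrNN mulr1.
have sn0 : s != 0.
  apply/eqP => s0; move: ss; rewrite s0 mul0r => /eqP.
  by rewrite eq_sym oner_eq0.
(* The factor [s] makes w x a and w x a' the directions that point into the face along both
   edges. *)
pose w := s *: fnor f.
have ww : dot w w = 1 by rewrite dotZl dotZr nn mulr1.
have aw : dot a w = 0 by rewrite dotZr an mulr0.
have aw' : dot a' w = 0 by rewrite dotZr an' mulr0.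
have wa : cross w a = cross (fnor f) t by rewrite tE crossZl crossZr.
have wa' : cross w a' = cross (fnor f) t' by rewrite tE' crossZl crossZr.
have [int rayE] := eset_from_end me; have [int' rayE'] := eset_from_end me'.
have fm : fset f (vpos m) := bedges_sub ef (eset_end me).
have wn y : dot y w = 0 -> dot y (fnor f) = 0.
  by rewrite dotZr => /eqP; rewrite mulf_eq0 (negbTE sn0) => /eqP.
have near_int e0 a0 :
    (forall s, 0 < s < elen e0 -> erelint e0 (vpos m + s *: a0)) ->
    \forall s \near 0^'+, erelint e0 (vpos m + s *: a0).
  move=> int0; near=> u; apply: int0; apply/andP; split; near: u.
    exact: nbhs_right_gt.
  by apply: nbhs_right_lt; exact: elen_gt0.
have E : a = a'.
  apply: (two_rays (A := fset f) (B := frelbd f) (x := vpos m)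
    ww aa aa' aw aw').
  - by move=> P Q /wn Pm /wn Qm; exact: face_segment fm Pm Qm.
  - by apply: filterS (near_int _ _ int) => u /ht; rewrite wa.
  - by apply: filterS (near_int _ _ int') => u /ht'; rewrite wa'.
  - have cl := near_closed_family (vpos m) (@eset_closed R T).
    apply: filterS cl => y clos _.
    rewrite (face_boundary hT) => -[e0 /= e0f e0y].
    have [E|E] := only e0 e0f (vertex_of_edge (clos _ e0y)).
      by rewrite E in e0y; have [b b0 ->] := rayE _ e0y; exists b => //; left.
    by rewrite E in e0y; have [b b0 ->] := rayE' _ e0y; exists b => //; right.
have [u [iu iu']] : exists u, erelint e (vpos m + u *: a) /\
    erelint e' (vpos m + u *: a').
  near ((0 : R)^'+) => u; exists u; split; near: u; exact: near_int.
rewrite -E in iu'; have := erelint_uniq hT iu (erelint_sub iu').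
by move=> e'e; rewrite e'e eqxx in ee'.
Unshelve. all: by end_near. Qed.

End Vertices.

(** * The weak curl of a weak gradient *)

(** Negation exchanges the positive and negative parts, and an infinite difference of their
    integrals is read as 0 on both sides; signs can thus be moved without integrability. *)
Lemma RintegralN d (Y : measurableType d) (R : realType)
    (mu : {measure set Y -> \bar R}) (D : set Y) (g : Y -> R) :
  \int[mu]_(x in D) (- g x) = - \int[mu]_(x in D) g x.
Proof.
rewrite /Rintegral integralE [in RHS]integralE.
rewrite (_ : (fun x => (- g x)%:E) = (\- (EFin \o g))%E) //.
rewrite funeposN funenegN.
have := @integral_ge0 _ _ _ mu D _ (fun x _ => funepos_ge0 (EFin \o g) x).
have := @integral_ge0 _ _ _ mu D _ (fun x _ => funeneg_ge0 (EFin \o g) x).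
move: (integral _ _ _) (integral _ _ _) => [a| |] [b| |] //= _ _.
all: by rewrite ?oppr0 // opprB.
Qed.

Section Complex.
Variables (R : realType) (T : solid_complex R).
Hypothesis hT : is_polyhedron T.
Local Notation poly3 := (mpoly 3 R).
Implicit Types (f : face T) (e : edge T) (m : vertex T) (x y : 'rV[R]_3).

Lemma intF_sign f (s : R) (g : 'rV[R]_3 -> R) : s ^+ 2 = 1 ->
  intF f (fun x => s * g x) = s * intF f g.
Proof.
move=> /eqP; rewrite sqrf_eq1 => /orP[] /eqP ->; rewrite /intF.
  by rewrite mul1r; apply: eq_Rintegral => x _; rewrite mul1r.
by rewrite mulN1r -RintegralN; apply: eq_Rintegral => x _; rewrite mulN1r.
Qed.

Lemma intE_sign e (s : R) (g : 'rV[R]_3 -> R) : s ^+ 2 = 1 ->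
  intE e (fun x => s * g x) = s * intE e g.
Proof.
move=> /eqP; rewrite sqrf_eq1 => /orP[] /eqP ->; rewrite /intE.
  by rewrite mul1r; apply: eq_Rintegral => x _; rewrite mul1r.
by rewrite mulN1r -RintegralN; apply: eq_Rintegral => x _; rewrite mulN1r.
Qed.

Lemma sign_scale (u v : 'rV[R]_3) : dot v v = 1 -> u = v \/ u = - v ->
  exists2 s : R, s ^+ 2 = 1 & u = s *: v.
Proof.
move=> vv [->|->]; first by exists 1; rewrite ?expr1n ?scale1r.
by exists (-1); rewrite ?sqrrN ?expr1n ?scaleN1r.
Qed.

Variables (n : face T -> 'rV[R]_3) (t : face T -> edge T -> 'rV[R]_3).
Hypothesis hn : forall f, outward_normal f (n f).
Hypothesis ht : forall f e, e \in bedges f -> right_hand_tangent f e (t f e).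

Lemma tangent_sign : exists s : face T -> edge T -> R, forall f e,
  e \in bedges f -> s f e ^+ 2 = 1 /\ t f e = s f e *: etan e.
Proof.
have H (fe : face T * edge T) : exists s : R, fe.2 \in bedges fe.1 ->
    s ^+ 2 = 1 /\ t fe.1 fe.2 = s *: etan fe.2.
  case: (boolP (fe.2 \in bedges fe.1)) => [/ht [te _]|_]; last by exists 0.
  by have [s s2 sE] := sign_scale (etan_unit hT fe.2) te; exists s.
have [s sP] := choice H.
by exists (fun f e => s (f, e)) => f e ef; exact: (sP (f, e)).
Qed.

Lemma normal_sign : exists s : face T -> R, forall f,
  s f ^+ 2 = 1 /\ n f = s f *: fnor f.
Proof.
have /choice [s sP] : forall f, exists s : R, s ^+ 2 = 1 /\ n f = s *: fnor f.
  move=> f; have [nf _] := hn f; have [_ _ nn] := frame_unit hT f.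
  by have [s s2 sE] := sign_scale nn nf; exists s.
by exists s.
Qed.

Lemma sum_edge_signs (s : face T -> R) (s' : face T -> edge T -> R) e :
  (forall f, s f ^+ 2 = 1 /\ n f = s f *: fnor f) ->
  (forall f e, e \in bedges f -> s' f e ^+ 2 = 1 /\ t f e = s' f e *: etan e) ->
  \sum_(f | e \in bedges f) s f * s' f e = 0.
Proof.
move=> sP s'P.
have /eqP/cards2P [f [f' [ff' E]]] := edge_faces hT e.
have mem g : (e \in bedges g) = (g \in [set f; f']%SET) by rewrite -E inE.
have ef : e \in bedges f by rewrite mem !inE eqxx.
have ef' : e \in bedges f' by rewrite mem !inE eqxx orbT.
rewrite (eq_bigl _ _ mem) big_setU1 ?inE //= big_set1.
have [s2 nE] := sP f; have [s2' nE'] := sP f'.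
have only g : e \in bedges g -> g = f \/ g = f'.
  by rewrite mem !inE => /orP[] /eqP; [left|right].
have := edge_orientation hT (hn f) (hn f') (ht ef) (ht ef') ef ef' ff' only
  nE nE' s2 s2'.
have tE g : e \in bedges g -> dot (t g e) (etan e) = s' g e.
  move=> /s'P [_ ->]; rewrite (dotZl (s' g e)) (etan_unit hT); exact: mulr1.
by move=> /(congr1 (fun v => dot v (etan e)));
  rewrite dotDl (dotZl (s f)) (dotZl (s f')) dot0l !tE.
Qed.

Lemma sum_vertex_signs f m :
  \sum_(e in bedges f | m \in ends e) dot (t f e) (eout e m) = 0.
Proof.
have [fm|nfm] := pselect (fset f (vpos m)); last first.
  rewrite big1 // => e /andP[ef me]; exfalso; apply: nfm.
  exact: bedges_sub ef _ (eset_end me).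
have /eqP/cards2P [e [e' [ee' E]]] := face_vertex hT fm.
have mem e0 : (e0 \in bedges f) && (m \in ends e0) = (e0 \in [set e; e']%SET).
  by rewrite -E inE.
rewrite (eq_bigl _ _ mem) big_setU1 ?inE //= big_set1.
have /andP[ef me] : (e \in bedges f) && (m \in ends e) by rewrite mem !inE eqxx.
have /andP[ef' me'] : (e' \in bedges f) && (m \in ends e').
  by rewrite mem !inE eqxx orbT.
apply: (vertex_orientation hT (ht ef) (ht ef')) => // e0 e0f me0.
have : e0 \in [set e; e']%SET by rewrite -mem e0f.
by rewrite !inE => /orP[] /eqP; [left|right].
Qed.

Lemma tangent_orth f e : e \in bedges f -> dot (t f e) (fnor f) = 0.
Proof. by move=> ef; have [te _] := ht ef; exact: tangent_fnor ef te. Qed.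

Lemma wcurl_0_wgrad a b c a' j0 j1 j2 (v : cochain1 T) :
  space1 j0 j1 j2 v -> (a' <= a)%N -> (a' <= b)%N ->
  wcurl_0 n a' (wgrad n t a b c v) = fun=> 0.
Proof.
(* Without a solution, [xget] returns the zero field, which is the claim. *)
move=> hv a'a a'b; rewrite /wcurl_0; case: xgetP => [w _ [wX weq]|//].
have iT := integral_on_solid hT.
have [s sP] := normal_sign; have [s' s'P] := tangent_sign.
suff zero theta : vdegle a' theta ->
    intT T (fun x => dot (w x) (veval theta x)) = 0.
  have /choice [q qP] : forall i, exists p, [/\ degle a' p,
      (forall x, solid T x -> w x 0 i = peval p x) &
      forall x, ~ solid T x -> w x 0 i = 0].
    by move=> i; exact: Pspace_poly (wX i).
  pose Q := \row_(i < 3) q i.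
  (* Testing [w] against its own polynomial representative annihilates its square integral. *)
  have Q0 : intT T (peval (pdot Q Q)) = 0.
    rewrite -(zero Q) => [|i]; last by rewrite mxE; have [] := qP i.
    apply: intT_ext => x Tx; rewrite /pdot peval_sum; apply: eq_bigr => i _.
    by rewrite pevalM !mxE; have [_ -> //] := qP i.
  apply/funext => x; apply/rowP => i; rewrite mxE.
  have [_ qT qN] := qP i; have [Tx|/qN //] := pselect (solid T x).
  by rewrite qT //; have := integral_pdot_eq0 iT Q0 i Tx; rewrite mxE.
move=> thetaa; rewrite weq //=.
have curla : vdegle a (curl theta).
  by apply: vdegle_curl => i; exact: degle_leq a'a (thetaa i).
have thetab : vdegle b theta by move=> i; exact: degle_leq a'b (thetaa i).
rewrite (wgrad_0_spec hT n a hv).2 //.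
have -> : intT T (fun x => v_0 v x * peval (div (curl theta)) x) = 0.
  rewrite -(integral_on0 iT); apply: intT_ext => x _.
  by rewrite div_curl peval0 mulr0.
rewrite oppr0 add0r -big_split /=.
pose J e := intE e (fun x => v_e v e x * dot (veval theta x) (etan e)).
transitivity (\sum_f \sum_(e in bedges f) s f * s' f e * J e).
  apply: eq_bigr => f _; have [s2 ->] := sP f.
  pose A := intF f (fun x => v_f v f x * dot (veval (curl theta) x) (fnor f)).
  have -> : intF f (fun x =>
      v_f v f x * dot (veval (curl theta) x) (s f *: fnor f)) = s f * A.
    by rewrite -intF_sign //; apply: intF_ext => x _; rewrite dotZr mulrCA.
  (* The sign of [n f] relative to [fnor f] multiplies both face terms, so the two copies of [A]
     cancel and only edge integrals remain. *)
  transitivity (s f * A + s f * (- A + \sum_(e in bedges f)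
      intE e (fun x => v_e v e x * dot (veval theta x) (t f e)))).
    apply: (congr2 (fun y z : R => y + z)) => //.
    rewrite -(wgrad_f_spec hT b (tangent_orth (f := f)) hv).2 //.
    rewrite -intF_sign //; apply: intF_ext => x _.
    by rewrite crossZr dotZr.
  rewrite mulrDr mulrN addrA subrr add0r mulr_sumr; apply: eq_bigr => e ef.
  have [s2' ->] := s'P _ _ ef.
  rewrite -mulrA -[s' f e * _]intE_sign //; congr (_ * _).
  by apply: (intE_ext hT) => x _; rewrite dotZr mulrCA.
rewrite (exchange_big_dep xpredT) //= big1 // => e _.
by rewrite -mulr_suml (sum_edge_signs _ sP s'P) mul0r.
Qed.

Lemma wcurl_f_wgrad a b c b' j0 j1 j2 (v : cochain1 T) f :
  space1 j0 j1 j2 v -> (b' <= b)%N -> (b' <= c)%N ->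
  wcurl_f t b' (wgrad n t a b c v) f = fun=> 0.
Proof.
move=> hv b'b b'c; rewrite /wcurl_f; case: xgetP => [w _ [wN weq]|//].
have iF := integral_on_face hT f; have [_ _ nn] := frame_unit hT f.
have [s' s'P] := tangent_sign.
have [wf /Pspace_poly [q [qb qE qN]] wE] := wN.
suff zero : intF f (fun x => dot (w x) (peval q x *: fnor f)) = 0.
  have q0 x : fset f x -> peval q x = 0.
    move=> fx; apply/eqP; rewrite -[_ == 0](sqrf_eq0 (peval q x)).
    have := integral_on_definite iF (p := q * q).
    rewrite expr2 -pevalM => -> //.
      by move=> y _; rewrite pevalM -expr2 sqr_ge0.
    rewrite -[RHS]zero; apply: intF_ext => y fy.
    by rewrite wE dotZl dotZr nn mulr1 qE // pevalM.
  apply/funext => x; rewrite wE.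
  have [fx|nfx] := pselect (fset f x); first by rewrite qE // q0 // scale0r.
  by rewrite qN // scale0r.
have gradb : vdegle b (grad q) by apply: vdegle_grad; exact: degle_leq b'b qb.
rewrite weq //= (wgrad_f_spec hT b (tangent_orth (f := f)) hv).2 //.
have -> : intF f (fun x =>
    v_f v f x * dot (veval (curl (grad q)) x) (fnor f)) = 0.
  rewrite -(integral_on0 iF); apply: intF_ext => x _.
  rewrite curl_grad peval0 /dot big1 ?mulr0 // => i _.
  by rewrite !mxE peval0 mul0r.
rewrite oppr0 add0r -big_split /=.
transitivity (\sum_(e in bedges f) \sum_(m in ends e)
    v_n v m * peval q (vpos m) * dot (t f e) (eout e m)).
  apply: eq_bigr => e ef; have [s2 ->] := s'P _ _ ef.
  pose J := intE e (fun x => v_e v e x * dot (veval (grad q) x) (etan e)).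
  have -> : intE e (fun x =>
      v_e v e x * dot (veval (grad q) x) (s' f e *: etan e)) = s' f e * J.
    by rewrite -intE_sign //; apply: (intE_ext hT) => x _; rewrite dotZr mulrCA.
  transitivity (s' f e * J + s' f e * (- J + \sum_(m in ends e)
      v_n v m * (peval q (vpos m) * dot (etan e) (eout e m)))).
    apply: (congr2 (fun y z : R => y + z)) => //.
    rewrite -(wgrad_e_spec hT c e hv).2; last exact: degle_leq b'c qb.
    rewrite -intE_sign //; apply: (intE_ext hT) => x _.
    by rewrite scalerA (mulrC (peval q x)) -scalerA dotZr.
  rewrite mulrDr mulrN addrA subrr add0r mulr_sumr; apply: eq_bigr => m _.
  by rewrite (dotZl (s' f e)); ring.
rewrite (exchange_big_dep xpredT) //= big1 // => m _.
by rewrite -mulr_sumr sum_vertex_signs mulr0.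
Qed.

(** The inequalities admit, in this order, curl theta in the volume gradient, theta in the face
    gradients, grad tau in the face gradients and tau in the edge gradients. *)
Lemma wcurl_wgrad a b c a' b' j0 j1 j2 (v : cochain1 T) :
  space1 j0 j1 j2 v ->
  (a' <= a)%N -> (a' <= b)%N -> (b' <= b)%N -> (b' <= c)%N ->
  wcurl n t a' b' (wgrad n t a b c v) = zero3 T.
Proof.
move=> hv a'a a'b b'b b'c; rewrite /wcurl (wcurl_0_wgrad c hv) //.
congr Cochain3; apply/funext => f; by apply: wcurl_f_wgrad hv _ _.
Qed.

End Complex.

Theorem lemma3p1 (R : realType) (T : solid_complex R) (hT : is_polyhedron T)
    (n : face T -> 'rV[R]_3) (t : face T -> edge T -> 'rV[R]_3)
    (hn : forall f : face T, outward_normal f (n f))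
    (ht : forall (f : face T) (e : edge T),
        e \in bedges f -> right_hand_tangent f e (t f e)) :
  (forall (k : nat) (v : cochain1 T), V1 k v ->
     wcurl n t k k (wgrad n t k k k v) = zero3 T) /\
  (forall (k : nat), (3 <= k)%N -> forall v : cochain1 T, W1 k v ->
     wcurl n t (k - 2) (k - 3) (wgrad n t (k - 1) (k - 2) (k - 3) v)
     = zero3 T).
Proof.
split=> [k v hv|k k3 v hv]; apply: (wcurl_wgrad hT hn ht hv) => //.
- by rewrite leq_sub2l.
- by rewrite leq_sub2l.
Qed.
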